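(* Let $X$ be a weak $\omega$-category, $n\geq 1$, and $u,v\colon x\to y$ a parallel pair of $n$-cells in $X$ such that $u\sim v$. Suppose that $u$ is invertible. Then $v$ is invertible too.
   Context: **Globular sets.** A globular set $X$ consists of sets $X_n$ ($n\ge 0$), whose elements are called $n$-cells, and maps $s^X_n,t^X_n\colon X_{n+1}\to X_n$ with $s_n^Xs_{n+1}^X=s_n^Xt_{n+1}^X$ and $t_n^Xs_{n+1}^X=t_n^Xt_{n+1}^X$ (equivalently, a presheaf on the globe category). Morphisms commute with all $s,t$; the category is $\mathbf{GSet}$. For $m<n$, $s^X_m,t^X_m\colon X_n\to X_m$ denote the iterated source and target maps. Two $n$-cells are parallel if $n=0$, or $n\ge 1$ and they have the same $s^X_{n-1}$ and the same $t^X_{n-1}$. For $n\ge1$ and an $n$-cell $u$, $u\colon x\to y$ means $s^X_{n-1}(u)=x$, $t^X_{n-1}(u)=y$. $G^n$ is the representable globular set, so morphisms $G^n\to X$ correspond to $n$-cells of $X$; $\iota_n\colon\partial G^n\to G^n$ is the inclusion of the largest proper globular subset. For $n\ge 1$, morphisms $\partial G^n\to X$ correspond to parallel pairs $(u,v)$ of $(n-1)$-cells; the corresponding morphism is written $\langle u,v\rangle$. $1$ is the terminal globular set. **The monad $T$.** $T=(T,\eta^T,\mu^T)$ is the monad on $\mathbf{GSet}$ induced by the monadic forgetful functor from small strict $\omega$-categories and strict $\omega$-functors. It is described as follows. A pasting scheme of rank $r\ge0$ is a table of non-negative integers $\boldsymbol{k}=\begin{bmatrix}k_0&&k_1&&\dots&&k_r\\&\underline{k}_1&&\underline{k}_2&\dots&\underline{k}_r&\end{bmatrix}$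 with $k_{i-1}>\underline k_i<k_i$ for $1\le i\le r$; it is of dimension $n$ if $k_i\le n$ for all $i$. A pasting diagram of shape $\boldsymbol k$ in $X$ is a table $\boldsymbol{u}=\begin{bmatrix}u_0&&u_1&&\dots&&u_r\\&\underline{u}_1&&\underline{u}_2&\dots&\underline{u}_r&\end{bmatrix}$ with $u_i\in X_{k_i}$, $\underline u_i\in X_{\underline k_i}$ and $t^X_{\underline k_i}(u_{i-1})=\underline u_i=s^X_{\underline k_i}(u_i)$ for $1\le i\le r$. Then $(TX)_n$ is the set of pasting diagrams in $X$ of dimension $n$ (i.e. whose shape is of dimension $n$); in particular $(T1)_n$ is the set of pasting schemes of dimension $n$, $T!\colon TX\to T1$ sends a diagram to its shape, and $Tf$ applies $f$ entrywise. When a scheme or diagram is regarded as an $n$-cell we may write a superscript $(n)$. An $n$-cell $\boldsymbol k$ of $T1$ is degenerate if $\max_i k_i<n$. For $m<n$, an $m$-transversal component of $\boldsymbol k$ is given by indices $0\le i\le j\le r$ such that $k_l>m$ for $i\le l\le j$, $\underline k_l\ge m$ for $i+1\le l\le j$, either $i=0$ or $\underline k_i<m$, and either $j=r$ or $\underline k_{j+1}<m$. $s^{TX}_m(\boldsymbol u)$ (resp. $t^{TX}_m(\boldsymbol u)$) is obtained from $\boldsymbol u$ by replacing, for each $m$-transversal component $i\le j$, the segment $u_i,\underline u_{i+1},\dots,\underline u_j,u_j$ by the single top-row entry $s^X_m(u_i)$ (resp. $t^X_m(u_j)$). The unit sends $x\in X_n$ to the one-entry diagram $[x]$ (so $\eta^T_1$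 picks out $[n]\in(T1)_n$), and $\mu^T_X$ glues a pasting diagram of pasting diagrams together. **Weak $\omega$-categories (Leinster).** $T$ is a cartesian monad. A cartesian monad over $T$ with contraction is a monad $P$ on $\mathbf{GSet}$ with a monad morphism $\mathrm{ar}^P\colon P\to T$ all of whose naturality squares are pullbacks, together with a function $\kappa^P$ assigning to each $n\ge1$, $u\colon\partial G^n\to P1$, $v\colon G^n\to T1$ with $\mathrm{ar}^P_1\circ u=v\circ\iota_n$ a morphism $\kappa^P(u,v)\colon G^n\to P1$ with $\kappa^P(u,v)\circ\iota_n=u$ and $\mathrm{ar}^P_1\circ\kappa^P(u,v)=v$. Morphisms are monad morphisms $\alpha\colon P\to Q$ with $\mathrm{ar}^Q\circ\alpha=\mathrm{ar}^P$ and $\alpha_1\circ\kappa^P(u,v)=\kappa^Q(\alpha_1\circ u,v)$. This category has an initial object $(L,\mathrm{ar}^L,\kappa^L)$; write $\mathrm{ar}_X=\mathrm{ar}^L_X$, $\mathrm{ar}=\mathrm{ar}^L_1\colon L1\to T1$, $\kappa=\kappa^L$. A weak $\omega$-category is an Eilenberg–Moore algebra $(X,\xi\colon LX\to X)$ of the monad $L$; a strict $\omega$-functor is a morphism of $L$-algebras. Since $LX$ is the pullback of $T!\colon TX\to T1$ and $\mathrm{ar}$, an $n$-cell of $LX$ is a pair $(\phi,\boldsymbol u)$ with $\phi\in(L1)_n$ and $\boldsymbol u\in(TX)_n$ of shape $\mathrm{ar}(\phi)$, with sources and targets taken componentwise. For parallel $\phi,\phi'\in(L1)_{n-1}$ and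 $\boldsymbol k\in(T1)_n$ with $\mathrm{ar}(\phi)=s^{T1}_{n-1}(\boldsymbol k)=t^{T1}_{n-1}(\boldsymbol k)=\mathrm{ar}(\phi')$, $\kappa(\langle\phi,\phi'\rangle,\boldsymbol k)\in(L1)_n$ is a cell $\phi\to\phi'$ of arity $\boldsymbol k$. **Identities and composition.** Let $\widetilde e_n\in(L1)_n$ be the image under $\eta^L_1$ of the unique $n$-cell of $1$. The standard pasting instruction $\mathrm{sp}(\boldsymbol k)\in(L1)_n$ of $\boldsymbol k\in(T1)_n$ is defined inductively on $n$: $\mathrm{sp}([n])=\widetilde e_n$, and otherwise $\mathrm{sp}(\boldsymbol k)=\kappa(\langle\mathrm{sp}(\boldsymbol k'),\mathrm{sp}(\boldsymbol k')\rangle,\boldsymbol k)$ where $\boldsymbol k'=s^{T1}_{n-1}(\boldsymbol k)=t^{T1}_{n-1}(\boldsymbol k)$. In a weak $\omega$-category $(X,\xi)$ and for $n\ge1$: for $x\in X_{n-1}$ put $\mathrm{id}_n(x)=\xi(\mathrm{sp}([n-1]^{(n)}),[x])$, an $n$-cell $x\to x$; for $n$-cells $u\colon x\to y$, $v\colon y\to z$ put $u\ast_{n-1}v=\xi\Bigl(\mathrm{sp}\Bigl(\begin{bmatrix}n&&n\\&n-1&\end{bmatrix}\Bigr),\begin{bmatrix}u&&v\\&y&\end{bmatrix}\Bigr)$, an $n$-cell $x\to z$. **Invertible cells.** Invertible means weakly invertible, defined coinductively. For $S\subseteq\coprod_nX_n$ let $\Phi^X(S)$ be the set of all cells $u\colon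 x\to y$ of dimension $n\ge1$ for which there exist an $n$-cell $v\colon y\to x$ and $(n+1)$-cells $p\colon u\ast_{n-1}v\to\mathrm{id}_n(x)$ and $q\colon v\ast_{n-1}u\to\mathrm{id}_n(y)$ in $S$. The set of invertible cells of $X$ is the greatest fixed point (equivalently, the greatest $W$ with $W\subseteq\Phi^X(W)$) of the monotone map $\Phi^X$. An inverse of an $n$-cell $u\colon x\to y$ is an $n$-cell $v\colon y\to x$ for which there are invertible $(n+1)$-cells $u\ast_{n-1}v\to\mathrm{id}_n(x)$ and $v\ast_{n-1}u\to\mathrm{id}_n(y)$. For $n$-cells $x,y$ ($n\ge0$), $x\sim y$ means that there is an invertible $(n+1)$-cell $x\to y$. *)

(* Defs.v *)
From mathcomp Require Import all_boot.
From mathcomp Require Import zify.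
From Stdlib Require Import ProofIrrelevance ClassicalEpsilon.

Set Implicit Arguments.
Unset Strict Implicit.
Unset Printing Implicit Defensive.

Record gset := GSet {
  cell :> nat -> Type;
  src : forall n, cell n.+1 -> cell n;
  tgt : forall n, cell n.+1 -> cell n;
  src_src : forall n (x : cell n.+2), src (src x) = src (tgt x);
  tgt_src : forall n (x : cell n.+2), tgt (src x) = tgt (tgt x) }.
Arguments src {g n} x.
Arguments tgt {g n} x.

Definition gcell (X : gset) := {n : nat & X n}.
Definition gc (X : gset) n (x : X n) : gcell X := existT _ n x.
Definition dim (X : gset) (c : gcell X) : nat := projT1 c.

(* The cell itself when n <= m, its iterated m-source (m-target) when m < n. *)
Fixpoint src_cell (X : gset) (m n : nat) : X n -> gcell X :=
  match n with
  | 0 => fun x => gc x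
  | n'.+1 => fun x => if n'.+1 <= m then gc x else src_cell m (src x)
  end.
Fixpoint tgt_cell (X : gset) (m n : nat) : X n -> gcell X :=
  match n with
  | 0 => fun x => gc x
  | n'.+1 => fun x => if n'.+1 <= m then gc x else tgt_cell m (tgt x)
  end.
Definition src_to (X : gset) m (c : gcell X) := src_cell m (projT2 c).
Definition tgt_to (X : gset) m (c : gcell X) := tgt_cell m (projT2 c).

(* The table with upper row u_0, ..., u_r and lower row w_1, ..., w_r is
   Cons u_0 w_1 (Cons u_1 w_2 (... (One u_r))). *)
Inductive table (A : Type) := One of A | Cons of A & A & table A.

Definition thd A (t : table A) := match t with One u => u | Cons u _ _ => u end.
Fixpoint tlst A (t : table A) := match t with One u => u | Cons _ _ t' => tlst t' end.
Definition tset_hd A (x : A) t :=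
  match t with One _ => One x | Cons _ w t' => Cons x w t' end.
Fixpoint tmap A B (f : A -> B) t :=
  match t with One u => One (f u) | Cons u w t' => Cons (f u) (f w) (tmap f t') end.

Section Tables.
Context {X : gset}.
Implicit Types (u v w x y : gcell X) (t s r a b c : table (gcell X)).

(* The table t is a pasting diagram. *)
Fixpoint twf t : Prop :=
  match t with
  | One _ => True
  | Cons u w t' =>
      [/\ dim w < dim u, dim w < dim (thd t'), tgt_to (dim w) u = w,
          src_to (dim w) (thd t') = w & twf t']
  end.

(* Dimension n, for the shape of t. *)
Fixpoint tbounded n t : Prop :=
  match t with
  | One u => dim u <= n
  | Cons u _ t' => dim u <= n /\ tbounded n t'
  end.

(* The lower-row entries of dimension < m are kept, and between two consecutive ones
   (a segment) the table collapses to the m-source of the first upper-row entry,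
   or to the m-target of the last one.  A segment that is not an m-transversal
   component is a single entry of dimension <= m and is unchanged. *)
Fixpoint tsrc m t :=
  match t with
  | One u => One (src_to m u)
  | Cons u w t' =>
      if dim w < m then Cons (src_to m u) w (tsrc m t')
      else tset_hd (src_to m u) (tsrc m t')
  end.

Fixpoint ttgt m t :=
  match t with
  | One u => One (tgt_to m u)
  | Cons u w t' => if dim w < m then Cons (tgt_to m u) w (ttgt m t') else ttgt m t'
  end.

Lemma dim_src_to m u : dim (src_to m u) = minn m (dim u).
Proof.
case: u => n x; rewrite /src_to /=; elim: n x => [|n IH] x /=; first by rewrite /dim /=; lia.
by case: ifP => h /=; rewrite ?IH /dim /=; lia.
Qed.
Lemma dim_tgt_to m u : dim (tgt_to m u) = minn m (dim u).
Proof.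
case: u => n x; rewrite /tgt_to /=; elim: n x => [|n IH] x /=; first by rewrite /dim /=; lia.
by case: ifP => h /=; rewrite ?IH /dim /=; lia.
Qed.
Lemma src_to_id m u : dim u <= m -> src_to m u = u.
Proof. by case: u => [[|n] x] //=; rewrite /src_to /dim /= => ->. Qed.
Lemma tgt_to_id m u : dim u <= m -> tgt_to m u = u.
Proof. by case: u => [[|n] x] //=; rewrite /tgt_to /dim /= => ->. Qed.

Lemma src_cell_st k n (x : X n.+1) : k < n -> src_cell k (src x) = src_cell k (tgt x).
Proof. by case: n x => // n x kn /=; rewrite leqNgt kn src_src. Qed.
Lemma tgt_cell_st k n (x : X n.+1) : k < n -> tgt_cell k (src x) = tgt_cell k (tgt x).
Proof. by case: n x => // n x kn /=; rewrite leqNgt kn tgt_src. Qed.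

Lemma src_src_to k m u : k <= m -> src_to k (src_to m u) = src_to k u.
Proof.
move=> km; case: u => n x; rewrite /src_to /=; elim: n x => // n IH x /=.
case: ifP => //= h; rewrite IH; case: ifP => //; lia.
Qed.
Lemma tgt_tgt_to k m u : k <= m -> tgt_to k (tgt_to m u) = tgt_to k u.
Proof.
move=> km; case: u => n x; rewrite /tgt_to /=; elim: n x => // n IH x /=.
case: ifP => //= h; rewrite IH; case: ifP => //; lia.
Qed.
Lemma src_tgt_to k m u : k < m -> src_to k (tgt_to m u) = src_to k u.
Proof.
move=> km; case: u => n x; rewrite /src_to /tgt_to /=; elim: n x => // n IH x /=.
case: ifP => //= h; rewrite IH ifN; last lia. rewrite src_cell_st //; lia.
Qed.
Lemma tgt_src_to k m u : k < m -> tgt_to k (src_to m u) = tgt_to k u.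
Proof.
move=> km; case: u => n x; rewrite /src_to /tgt_to /=; elim: n x => // n IH x /=.
case: ifP => //= h; rewrite IH ifN; last lia. rewrite tgt_cell_st //; lia.
Qed.
Lemma src_src_to' k m u : m <= k -> src_to k (src_to m u) = src_to m u.
Proof. by move=> mk; apply: src_to_id; rewrite dim_src_to; lia. Qed.
Lemma src_tgt_to' k m u : m <= k -> src_to k (tgt_to m u) = tgt_to m u.
Proof. by move=> mk; apply: src_to_id; rewrite dim_tgt_to; lia. Qed.
Lemma tgt_src_to' k m u : m <= k -> tgt_to k (src_to m u) = src_to m u.
Proof. by move=> mk; apply: tgt_to_id; rewrite dim_src_to; lia. Qed.
Lemma tgt_tgt_to' k m u : m <= k -> tgt_to k (tgt_to m u) = tgt_to m u.
Proof. by move=> mk; apply: tgt_to_id; rewrite dim_tgt_to; lia. Qed.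

Fixpoint tcat s w t :=
  match s with One u => Cons u w t | Cons u w' s' => Cons u w' (tcat s' w t) end.
Fixpoint tge m t : bool :=
  match t with One _ => true | Cons _ w t' => (m <= dim w) && tge m t' end.

Lemma hd_cat s w t : thd (tcat s w t) = thd s. Proof. by case: s. Qed.
Lemma lst_cat s w t : tlst (tcat s w t) = tlst t. Proof. by elim: s. Qed.
Lemma hd_set_hd x t : thd (tset_hd x t) = x. Proof. by case: t. Qed.
Lemma cat_set_hd x s w t : tcat (tset_hd x s) w t = tset_hd x (tcat s w t).
Proof. by case: s. Qed.
Lemma set_hd_id t : tset_hd (thd t) t = t. Proof. by case: t. Qed.
Lemma catA a u b w c : tcat (tcat a u b) w c = tcat a u (tcat b w c).
Proof. by elim: a => //= x y a ->. Qed.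
Lemma ge_cat m s w t : tge m (tcat s w t) = [&& tge m s, m <= dim w & tge m t].
Proof. by elim: s => //= u w' s ->; rewrite andbA. Qed.
Lemma ge_le m k t : k <= m -> tge m t -> tge k t.
Proof. by move=> km; elim: t => //= u w t IH /andP[h /IH ->]; rewrite andbT; lia. Qed.

Lemma wf_cat s w t : twf (tcat s w t) <->
  [/\ dim w < dim (tlst s), dim w < dim (thd t), tgt_to (dim w) (tlst s) = w,
      src_to (dim w) (thd t) = w & twf s /\ twf t].
Proof.
elim: s => [u|u w' s IH] /=; first by split=> [[]|[? ? ? ? []]].
rewrite hd_cat; split.
  by case=> h1 h2 h3 h4 /IH[h5 h6 h7 h8 [h9 h10]].
by case=> h1 h2 h3 h4 [[h5 h6 h7 h8 h9] h10]; split=> //; apply/IH.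
Qed.

Lemma bounded_cat n s w t : tbounded n (tcat s w t) <-> tbounded n s /\ tbounded n t.
Proof. by elim: s => //= u w' s IH; rewrite and_assoc IH. Qed.

Lemma seg_ind m (P : table (gcell X) -> Prop) :
  (forall s, tge m s -> P s) ->
  (forall s w t, tge m s -> dim w < m -> P t -> P (tcat s w t)) -> forall t, P t.
Proof.
move=> h1 h2 t.
suff: P t /\ forall s w, tge m s -> m <= dim w -> P (tcat s w t) by case.
elim: t => [u|u w t [IH1 IH2]].
  by split=> [|s w hs hw]; apply: h1; rewrite ?ge_cat ?hs ?hw.
case: (leqP m (dim w)) => h.
  split=> [|s w' hs hw']; first exact: (IH2 (One u)).
  by rewrite -[Cons u w t]/(tcat (One u) w t) -catA; apply: IH2; rewrite // ge_cat hs hw'.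
split=> [|s w' hs hw']; first exact: (h2 (One u)).
by rewrite -[Cons u w t]/(tcat (One u) w t) -catA; apply: h2; rewrite // ge_cat hs hw'.
Qed.

Lemma hd_tsrc m t : thd (tsrc m t) = src_to m (thd t).
Proof. by case: t => //= u w t; case: ifP; rewrite ?hd_set_hd. Qed.
Lemma lst_ttgt m t : tlst (ttgt m t) = tgt_to m (tlst t).
Proof. by elim: t => //= u w t; case: ifP. Qed.
Lemma tsrc_ge m t : tge m t -> tsrc m t = One (src_to m (thd t)).
Proof. by elim: t => //= u w t IH /andP[h /IH->]; rewrite ltnNge h. Qed.
Lemma ttgt_ge m t : tge m t -> ttgt m t = One (tgt_to m (tlst t)).
Proof. by elim: t => //= u w t IH /andP[h /IH->]; rewrite ltnNge h. Qed.
Lemma tsrc_cat m s w t : dim w < m -> tsrc m (tcat s w t) = tcat (tsrc m s) w (tsrc m t).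
Proof.
move=> h; elim: s => [u|u w' s IH] /=; first by rewrite h.
by rewrite IH; case: ifP => // _; rewrite cat_set_hd.
Qed.
Lemma ttgt_cat m s w t : dim w < m -> ttgt m (tcat s w t) = tcat (ttgt m s) w (ttgt m t).
Proof.
move=> h; elim: s => [u|u w' s IH] /=; first by rewrite h.
by rewrite IH; case: ifP.
Qed.
Lemma tsrc_id m t : twf t -> tbounded m t -> tsrc m t = t.
Proof.
elim: t => [u|u w t IH] /=; first by move=> _ /src_to_id->.
by case=> h1 h2 _ _ /IH{}IH [h3 /IH->]; rewrite ifT ?src_to_id //; lia.
Qed.
Lemma ttgt_id m t : twf t -> tbounded m t -> ttgt m t = t.
Proof.
elim: t => [u|u w t IH] /=; first by move=> _ /tgt_to_id->.
by case=> h1 h2 _ _ /IH{}IH [h3 /IH->]; rewrite ifT ?tgt_to_id //; lia.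
Qed.
Lemma bounded_le m n t : m <= n -> tbounded m t -> tbounded n t.
Proof. by move=> mn; elim: t => [u|u w t IH] /=; [lia|case=> ? /IH]; split=> //; lia. Qed.
Lemma bounded_tsrc m t : tbounded m (tsrc m t).
Proof.
elim/(@seg_ind m): t => [s hs|s w t hs hw IH].
  by rewrite tsrc_ge //= dim_src_to; lia.
by rewrite tsrc_cat // bounded_cat tsrc_ge //= dim_src_to; split=> //; lia.
Qed.
Lemma bounded_ttgt m t : tbounded m (ttgt m t).
Proof.
elim/(@seg_ind m): t => [s hs|s w t hs hw IH].
  by rewrite ttgt_ge //= dim_tgt_to; lia.
by rewrite ttgt_cat // bounded_cat ttgt_ge //= dim_tgt_to; split=> //; lia.
Qed.


Lemma seg_src m t k : twf t -> tge m t -> k < m -> src_to k (tlst t) = src_to k (thd t).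
Proof.
move=> W G km; elim: t W G => //= u w t IH [h1 h2 h3 h4 W] /andP[g G].
rewrite IH // -(@src_src_to k (dim w)) ?h4; last lia.
by rewrite -{1}h3 src_tgt_to //; lia.
Qed.
Lemma seg_tgt m t k : twf t -> tge m t -> k < m -> tgt_to k (thd t) = tgt_to k (tlst t).
Proof.
move=> W G km; elim: t W G => //= u w t IH [h1 h2 h3 h4 W] /andP[g G].
rewrite -IH // -(@tgt_tgt_to k (dim w)) ?h3; last lia.
by rewrite -{1}h4 tgt_src_to //; lia.
Qed.
Lemma seg_small m t : twf t -> tge m t ->
  (dim (thd t) <= m -> t = One (thd t)) /\ (dim (tlst t) <= m -> t = One (tlst t)).
Proof.
elim: t => //= u w t IH [h1 h2 h3 h4 W] /andP[g G].
have [i1 i2] := IH W G; split; first lia.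
by move=> l; move: h2; rewrite (i2 l) /=; lia.
Qed.
Lemma seg_dim m t : twf t -> tge m t -> (dim (tlst t) <= m) = (dim (thd t) <= m).
Proof.
move=> W G; have [h1 h2] := seg_small W G.
by apply/idP/idP => h; [rewrite (h2 h)|rewrite (h1 h)].
Qed.
Lemma seg_min m t : twf t -> tge m t -> minn m (dim (tlst t)) = minn m (dim (thd t)).
Proof.
move=> W G; have := seg_dim W G.
case: (leqP (dim (thd t)) m) => h e; last by lia.
by have [/(_ h) -> _] := seg_small W G; rewrite /=; lia.
Qed.
Lemma ge_tsrc k m t : tge k t -> tge k (tsrc m t).
Proof.
elim: t => //= u w t IH /andP[h /IH]; case: ifP => /= _; first by rewrite h.
by case: (tsrc m t).
Qed.
Lemma ge_ttgt k m t : tge k t -> tge k (ttgt m t).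
Proof. by elim: t => //= u w t IH /andP[h /IH]; case: ifP => //= _ ->; rewrite h. Qed.

Lemma hd_ttgt m k t : twf t -> k < m -> src_to k (thd (ttgt m t)) = src_to k (thd t).
Proof.
move=> + km; elim/(@seg_ind m): t => [s G W|s w t G wm _ /wf_cat[_ _ _ _ [W _]]].
  by rewrite ttgt_ge //= src_tgt_to // (seg_src W G).
by rewrite ttgt_cat // !hd_cat ttgt_ge //= src_tgt_to // (seg_src W G).
Qed.
Lemma lst_tsrc m k t : twf t -> k < m -> tgt_to k (tlst (tsrc m t)) = tgt_to k (tlst t).
Proof.
move=> + km; elim/(@seg_ind m): t => [s G W|s w t G wm IH /wf_cat[_ _ _ _ [_ W]]].
  by rewrite tsrc_ge //= tgt_src_to // (seg_tgt W G).
by rewrite tsrc_cat // !lst_cat IH.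
Qed.
Lemma dim_hd_ttgt m t : twf t -> dim (thd (ttgt m t)) = minn m (dim (thd t)).
Proof.
elim/(@seg_ind m): t => [s G W|s w t G wm _ /wf_cat[_ _ _ _ [W _]]].
  by rewrite ttgt_ge //= dim_tgt_to seg_min.
by rewrite ttgt_cat // !hd_cat ttgt_ge //= dim_tgt_to seg_min.
Qed.
Lemma dim_lst_tsrc m t : twf t -> dim (tlst (tsrc m t)) = minn m (dim (tlst t)).
Proof.
elim/(@seg_ind m): t => [s G W|s w t G wm IH /wf_cat[_ _ _ _ [_ W]]].
  by rewrite tsrc_ge //= dim_src_to seg_min.
by rewrite tsrc_cat // !lst_cat IH.
Qed.

Lemma wf_tsrc m t : twf t -> twf (tsrc m t).
Proof.
elim/(@seg_ind m): t => [s G W|s w t G wm IH]; first by rewrite tsrc_ge.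
rewrite tsrc_cat // => /wf_cat[h1 h2 h3 h4 [W1 /[dup] W2 /IH ?]]; apply/wf_cat.
rewrite dim_lst_tsrc // lst_tsrc // hd_tsrc dim_src_to src_src_to; last lia.
by rewrite tsrc_ge //; split=> //; lia.
Qed.
Lemma wf_ttgt m t : twf t -> twf (ttgt m t).
Proof.
elim/(@seg_ind m): t => [s G W|s w t G wm IH]; first by rewrite ttgt_ge.
rewrite ttgt_cat // => /wf_cat[h1 h2 h3 h4 [W1 /[dup] W2 /IH ?]]; apply/wf_cat.
rewrite dim_hd_ttgt // hd_ttgt // lst_ttgt dim_tgt_to tgt_tgt_to; last lia.
by rewrite ttgt_ge //; split=> //; lia.
Qed.

Lemma tsrc_tsrc k m t : k <= m -> tsrc k (tsrc m t) = tsrc k t.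
Proof.
move=> km; elim/(@seg_ind k): t => [s G|s w t G wm IH].
  by rewrite !(@tsrc_ge k) ?ge_tsrc // hd_tsrc src_src_to.
rewrite !tsrc_cat ?IH; try lia.
by congr (tcat _ w _); rewrite !(@tsrc_ge k) ?ge_tsrc // hd_tsrc src_src_to.
Qed.
Lemma ttgt_ttgt k m t : k <= m -> ttgt k (ttgt m t) = ttgt k t.
Proof.
move=> km; elim/(@seg_ind k): t => [s G|s w t G wm IH].
  by rewrite !(@ttgt_ge k) ?ge_ttgt // lst_ttgt tgt_tgt_to.
rewrite !ttgt_cat ?IH; try lia.
by congr (tcat _ w _); rewrite !(@ttgt_ge k) ?ge_ttgt // lst_ttgt tgt_tgt_to.
Qed.
Lemma tsrc_ttgt k m t : twf t -> k < m -> tsrc k (ttgt m t) = tsrc k t.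
Proof.
move=> + km; elim/(@seg_ind k): t => [s G W|s w t G wm IH /wf_cat[_ _ _ _ [W /IH{}IH]]].
  by rewrite !(@tsrc_ge k) ?ge_ttgt // hd_ttgt.
rewrite ttgt_cat ?tsrc_cat ?IH; try lia.
by congr (tcat _ w _); rewrite !(@tsrc_ge k) ?ge_ttgt // hd_ttgt.
Qed.
Lemma ttgt_tsrc k m t : twf t -> k < m -> ttgt k (tsrc m t) = ttgt k t.
Proof.
move=> + km; elim/(@seg_ind k): t => [s G W|s w t G wm IH /wf_cat[_ _ _ _ [W /IH{}IH]]].
  by rewrite !(@ttgt_ge k) ?ge_tsrc // lst_tsrc.
rewrite tsrc_cat ?ttgt_cat ?IH; try lia.
by congr (tcat _ w _); rewrite !(@ttgt_ge k) ?ge_tsrc // lst_tsrc.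
Qed.

(* [tcomp m a b] is the composite of [a] and [b] along dimension m, meant for
   ttgt m a = tsrc m b.  Then [a] and [b] have the same lower-row entries of
   dimension < m, and these cut both into matching segments.  A segment is either
   a single entry of dimension <= m or an m-transversal component.  Two
   m-transversal components are concatenated over their common m-boundary, and a
   single entry of dimension <= m acts as an identity. *)
Definition tjoin m u r :=
  if dim u <= m then r else if dim (thd r) <= m then tset_hd u r
  else Cons u (tgt_to m u) r.
Fixpoint tafter m (f : table (gcell X) -> table (gcell X)) b :=
  match b with
  | One v => One v
  | Cons v w b' => Cons v w (if dim w < m then f b' else tafter m f b')
  end.
Fixpoint tcomp m a b :=
  match a with
  | One u => tjoin m u b
  | Cons u w a' =>
      if dim w < m then tjoin m u (tafter m (tcomp m a') b) else Cons u w (tcomp m a' b)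
  end.

Lemma after_cat m f r w b : tge m r -> dim w < m -> tafter m f (tcat r w b) = tcat r w (f b).
Proof.
move=> + h; elim: r => [u|u w' r IH] /=; first by rewrite h.
by case/andP=> h' /IH->; rewrite ltnNge h'.
Qed.
Lemma join_cat m u r w b : tjoin m u (tcat r w b) = tcat (tjoin m u r) w b.
Proof. by rewrite /tjoin hd_cat; do 2![case: ifP => // _]; rewrite cat_set_hd. Qed.

End Tables.
Section Composition.
Context {X : gset}.
Implicit Types (u v w x y : gcell X) (t s r a b c d : table (gcell X)).

Lemma comp_cat m s r w w' a b : tge m s -> tge m r -> dim w < m -> dim w' < m ->
  tcomp m (tcat s w a) (tcat r w' b) = tcat (tcomp m s r) w' (tcomp m a b).
Proof.
move=> + gr wm w'm; elim: s => [u|u x s IH] /=.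
  by rewrite wm after_cat // join_cat.
by case/andP=> h /IH->; rewrite ltnNge h.
Qed.
Lemma comp_small m s r : twf s -> tge m s -> dim (tlst s) <= m -> tcomp m s r = r.
Proof. by move=> W G h; rewrite (proj2 (seg_small W G) h) /= /tjoin h. Qed.
Lemma comp_smallr m s r : tge m s -> tge m r -> twf r ->
  m < dim (tlst s) -> dim (thd r) <= m -> tcomp m s r = s.
Proof.
move=> G1 G2 W2 l1 l2; rewrite (proj1 (seg_small W2 G2) l2).
elim: s G1 l1 => [u|u w s IH] /=; first by move=> _ h; rewrite /tjoin leqNgt h /= l2.
by case/andP=> h /IH{}IH /IH->; rewrite ltnNge h.
Qed.
Lemma comp_big m s r : tge m s -> m < dim (tlst s) -> m < dim (thd r) ->
  tcomp m s r = tcat s (tgt_to m (tlst s)) r.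
Proof.
move=> G1 l1 l2.
elim: s G1 l1 => [u|u w s IH] /=; first by move=> _ h; rewrite /tjoin leqNgt h /= leqNgt l2.
by case/andP=> h /IH{}IH /IH->; rewrite ltnNge h.
Qed.
Lemma segP m t : tge m t \/ exists s w t', [/\ tge m s, dim w < m & t = tcat s w t'].
Proof.
elim/(@seg_ind X m): t => [s g|s w t g h _]; first by left.
by right; exists s, w, t.
Qed.

Lemma cat_inj m s w a r w' b : tge m s -> tge m r -> dim w < m -> dim w' < m ->
  tcat s w a = tcat r w' b -> [/\ s = r, w = w' & a = b].
Proof.
move=> gs gr h h'; elim: s r gs gr => [u|u x s IH] [v|v y r] //= gs gr.
- by case=> -> -> ->.
- by case=> _ e; move: gr; rewrite -e leqNgt h.
- by case=> _ e; move: gs; rewrite e leqNgt h'.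
- move: gs gr => /andP[_ gs] /andP[_ gr].
  by case=> -> -> /IH[] // -> -> ->.
Qed.

Lemma comp_ind m (P : table (gcell X) -> table (gcell X) -> Prop) :
  (forall s r, tge m s -> tge m r -> twf s -> twf r ->
     tgt_to m (tlst s) = src_to m (thd r) -> P s r) ->
  (forall s r w a b, tge m s -> tge m r -> dim w < m ->
     twf (tcat s w a) -> twf (tcat r w b) -> twf s -> twf r -> twf a -> twf b ->
     tgt_to m (tlst s) = src_to m (thd r) -> ttgt m a = tsrc m b ->
     P a b -> P (tcat s w a) (tcat r w b)) ->
  forall a b, twf a -> twf b -> ttgt m a = tsrc m b -> P a b.
Proof.
move=> h1 h2 a; elim/(@seg_ind X m): a => [s gs|s w a gs wm IH] b Wa Wb.
  have [gr|[r [w' [b' [gr h' e]]]]] := segP m b.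
    by rewrite ttgt_ge // tsrc_ge // => -[e]; exact: h1.
  by rewrite e tsrc_cat // ttgt_ge // tsrc_ge.
have [gr|[r [w' [b' [gr h' eb]]]]] := segP m b.
  by rewrite ttgt_cat // ttgt_ge // tsrc_ge.
subst b; rewrite ttgt_cat // tsrc_cat // ttgt_ge // tsrc_ge //= => -[e1 e2 e3].
subst w'.
move: (Wa) (Wb) => /wf_cat[_ _ _ _ [Ws Wa']] /wf_cat[_ _ _ _ [Wr Wb']].
by apply: h2 => //; exact: IH.
Qed.

Lemma seg_comp m s r : twf s -> twf r -> tge m s -> tge m r ->
  tgt_to m (tlst s) = src_to m (thd r) ->
  [\/ [/\ dim (tlst s) <= m, s = One (src_to m (thd r)) & tcomp m s r = r],
      [/\ m < dim (tlst s), dim (thd r) <= m, r = One (tgt_to m (tlst s)) & tcomp m s r = s]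
    | [/\ m < dim (tlst s), m < dim (thd r) & tcomp m s r = tcat s (tgt_to m (tlst s)) r]].
Proof.
move=> Ws Wr gs gr e; case: (leqP (dim (tlst s)) m) => h1.
  constructor 1; split=> //; last exact: comp_small.
  by rewrite -e tgt_to_id // (proj2 (seg_small Ws gs) h1).
case: (leqP (dim (thd r)) m) => h2.
  constructor 2; split=> //; last exact: comp_smallr.
  by rewrite e src_to_id // -(proj1 (seg_small Wr gr) h2).
by constructor 3; split=> //; exact: comp_big.
Qed.

Lemma ge_comp_seg k m s r : k <= m -> twf s -> twf r -> tge m s -> tge m r ->
  tgt_to m (tlst s) = src_to m (thd r) -> tge m (tcomp m s r).
Proof.
move=> km Ws Wr gs gr e.
case: (seg_comp Ws Wr gs gr e) => [[_ _ ->]|[_ _ _ ->]|[h1 _ ->]] //.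
by rewrite ge_cat gs gr dim_tgt_to andbT /=; lia.
Qed.
Lemma hd_comp_seg m s r : twf s -> twf r -> tge m s -> tge m r ->
  tgt_to m (tlst s) = src_to m (thd r) -> src_to m (thd (tcomp m s r)) = src_to m (thd s).
Proof.
move=> Ws Wr gs gr e.
case: (seg_comp Ws Wr gs gr e) => [[_ -> ->]|[_ _ _ ->]|[h1 _ ->]] //=.
  by rewrite src_src_to.
by rewrite hd_cat.
Qed.
Lemma lst_comp_seg m s r : twf s -> twf r -> tge m s -> tge m r ->
  tgt_to m (tlst s) = src_to m (thd r) -> tgt_to m (tlst (tcomp m s r)) = tgt_to m (tlst r).
Proof.
move=> Ws Wr gs gr e.
case: (seg_comp Ws Wr gs gr e) => [[_ _ ->]|[_ _ -> ->]|[h1 _ ->]] //=.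
  by rewrite tgt_tgt_to.
by rewrite lst_cat.
Qed.

Lemma tsrc_comp m a b : twf a -> twf b -> ttgt m a = tsrc m b ->
  tsrc m (tcomp m a b) = tsrc m a.
Proof.
move: a b; apply: comp_ind => [s r gs gr Ws Wr e|s r w a b gs gr wm _ _ Ws Wr _ _ e _ IH].
  by rewrite !tsrc_ge ?hd_comp_seg //; exact: (@ge_comp_seg m).
rewrite comp_cat // !tsrc_cat // IH; congr (tcat _ w _).
by rewrite !tsrc_ge ?hd_comp_seg //; exact: (@ge_comp_seg m).
Qed.
Lemma ttgt_comp m a b : twf a -> twf b -> ttgt m a = tsrc m b ->
  ttgt m (tcomp m a b) = ttgt m b.
Proof.
move: a b; apply: comp_ind => [s r gs gr Ws Wr e|s r w a b gs gr wm _ _ Ws Wr _ _ e _ IH].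
  by rewrite !ttgt_ge ?lst_comp_seg //; exact: (@ge_comp_seg m).
rewrite comp_cat // !ttgt_cat // IH; congr (tcat _ w _).
by rewrite !ttgt_ge ?lst_comp_seg //; exact: (@ge_comp_seg m).
Qed.

Lemma hd_comp m a b : twf a -> twf b -> ttgt m a = tsrc m b ->
  src_to m (thd (tcomp m a b)) = src_to m (thd a).
Proof. by move=> Wa Wb e; rewrite -!hd_tsrc tsrc_comp. Qed.
Lemma lst_comp m a b : twf a -> twf b -> ttgt m a = tsrc m b ->
  tgt_to m (tlst (tcomp m a b)) = tgt_to m (tlst b).
Proof. by move=> Wa Wb e; rewrite -!lst_ttgt ttgt_comp. Qed.

Lemma src_to_eq m u v : src_to m u = src_to m v ->
  minn m (dim u) = minn m (dim v) /\ forall k, k <= m -> src_to k u = src_to k v.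
Proof.
move=> e; split; first by rewrite -!dim_src_to e.
by move=> k km; rewrite -(src_src_to _ km) e src_src_to.
Qed.
Lemma tgt_to_eq m u v : tgt_to m u = tgt_to m v ->
  minn m (dim u) = minn m (dim v) /\ forall k, k <= m -> tgt_to k u = tgt_to k v.
Proof.
move=> e; split; first by rewrite -!dim_tgt_to e.
by move=> k km; rewrite -(tgt_tgt_to _ km) e tgt_tgt_to.
Qed.

Lemma wf_comp m a b : twf a -> twf b -> ttgt m a = tsrc m b -> twf (tcomp m a b).
Proof.
move: a b; apply: comp_ind => [s r gs gr Ws Wr e|s r w a b gs gr wm Wsa Wrb Ws Wr Wa Wb e e' IH].
  case: (seg_comp Ws Wr gs gr e) => [[_ _ ->]|[_ _ _ ->]|[h1 h2 ->]] //=.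
  apply/wf_cat; rewrite dim_tgt_to (minn_idPl (ltnW h1)).
  by split=> //; rewrite ?tgt_tgt_to.
rewrite comp_cat //.
move: Wsa Wrb => /wf_cat[h1 h2 h3 h4 _] /wf_cat[h1' h2' h3' h4' _].
have [i1 i2] := src_to_eq (hd_comp Wa Wb e').
have [j1 j2] := tgt_to_eq (lst_comp_seg Ws Wr gs gr e).
have We : twf (tcomp m s r) by
  case: (seg_comp Ws Wr gs gr e) => [[_ _ ->]|[_ _ _ ->]|[k1 k2 ->]] //=;
  apply/wf_cat; rewrite dim_tgt_to (minn_idPl (ltnW k1));
  split=> //; rewrite ?tgt_tgt_to.
apply/wf_cat; split=> //; try lia.
- by rewrite j2 // ltnW.
- by rewrite i2 // ltnW.
Qed.

Lemma ge_comp k m a b : k <= m -> twf a -> twf b -> ttgt m a = tsrc m b ->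
  tge k a -> tge k b -> tge k (tcomp m a b).
Proof.
move=> km; move: a b; apply: comp_ind => [s r gs gr Ws Wr e|s r w a b gs gr wm _ _ Ws Wr _ _ e _ IH].
  by move=> _ _; apply: (ge_le km); exact: (@ge_comp_seg m).
rewrite comp_cat // !ge_cat => /and3P[g1 h g2] /and3P[g3 _ g4].
by rewrite h IH // (ge_le km) //; exact: (@ge_comp_seg m).
Qed.

Lemma bounded_comp n m a b : twf a -> twf b -> ttgt m a = tsrc m b ->
  tbounded n a -> tbounded n b -> tbounded n (tcomp m a b).
Proof.
move: a b; apply: comp_ind => [s r gs gr Ws Wr e|s r w a b gs gr wm _ _ Ws Wr _ _ e _ IH].
  case: (seg_comp Ws Wr gs gr e) => [[_ _ ->]|[_ _ _ ->]|[k1 k2 ->]] //=.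
  by rewrite bounded_cat.
rewrite comp_cat // !bounded_cat => -[b1 b2] [b3 b4]; split; last exact: IH.
case: (seg_comp Ws Wr gs gr e) => [[_ _ ->]|[_ _ _ ->]|[k1 k2 ->]] //=.
by rewrite bounded_cat.
Qed.

Lemma tsrc_comp_gt k m a b : m < k -> twf a -> twf b -> ttgt m a = tsrc m b ->
  tsrc k (tcomp m a b) = tcomp m (tsrc k a) (tsrc k b).
Proof.
move=> mk; move: a b.
have base s r : tge m s -> tge m r -> twf s -> twf r -> tgt_to m (tlst s) = src_to m (thd r) ->
    tsrc k (tcomp m s r) = tcomp m (tsrc k s) (tsrc k r).
  move=> gs gr Ws Wr e.
  have [gs' gr'] := (ge_tsrc k gs, ge_tsrc k gr).
  have [Ws' Wr'] := (wf_tsrc k Ws, wf_tsrc k Wr).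
  case: (seg_comp Ws Wr gs gr e) => [[h1 _ ->]|[h1 h2 _ ->]|[h1 h2 ->]] //=.
  - by rewrite comp_small // dim_lst_tsrc //; lia.
  - by rewrite comp_smallr // ?dim_lst_tsrc // ?hd_tsrc ?dim_src_to; lia.
  - rewrite tsrc_cat ?dim_tgt_to; last lia.
    by rewrite comp_big ?lst_tsrc // ?dim_lst_tsrc // ?hd_tsrc ?dim_src_to; lia.
apply: comp_ind => // s r w a b gs gr wm _ _ Ws Wr _ _ e _ IH.
by rewrite comp_cat // !tsrc_cat ?IH ?base ?comp_cat ?ge_tsrc //; lia.
Qed.
Lemma ttgt_comp_gt k m a b : m < k -> twf a -> twf b -> ttgt m a = tsrc m b ->
  ttgt k (tcomp m a b) = tcomp m (ttgt k a) (ttgt k b).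
Proof.
move=> mk; move: a b.
have base s r : tge m s -> tge m r -> twf s -> twf r -> tgt_to m (tlst s) = src_to m (thd r) ->
    ttgt k (tcomp m s r) = tcomp m (ttgt k s) (ttgt k r).
  move=> gs gr Ws Wr e.
  have [gs' gr'] := (ge_ttgt k gs, ge_ttgt k gr).
  have [Ws' Wr'] := (wf_ttgt k Ws, wf_ttgt k Wr).
  case: (seg_comp Ws Wr gs gr e) => [[h1 _ ->]|[h1 h2 _ ->]|[h1 h2 ->]] //=.
  - by rewrite comp_small // lst_ttgt dim_tgt_to; lia.
  - by rewrite comp_smallr // ?dim_hd_ttgt // ?lst_ttgt ?dim_tgt_to; lia.
  - rewrite ttgt_cat ?dim_tgt_to; last lia.
    rewrite comp_big ?lst_ttgt ?dim_hd_ttgt ?dim_tgt_to // ?tgt_tgt_to //; lia.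
apply: comp_ind => // s r w a b gs gr wm _ _ Ws Wr _ _ e _ IH.
by rewrite comp_cat // !ttgt_cat ?IH ?base ?comp_cat ?ge_ttgt //; lia.
Qed.

Lemma comp_src m a : twf a -> tcomp m (tsrc m a) a = a.
Proof.
elim/(@seg_ind X m): a => [s gs Ws|s w a gs wm IH /wf_cat[_ _ _ _ [Ws Wa]]].
  by rewrite tsrc_ge // comp_small //= dim_src_to; lia.
rewrite tsrc_cat // comp_cat ?ge_tsrc // IH // tsrc_ge //.
by rewrite comp_small //= dim_src_to; lia.
Qed.
Lemma comp_tgt m a : twf a -> tcomp m a (ttgt m a) = a.
Proof.
have base s : tge m s -> twf s -> tcomp m s (ttgt m s) = s.
  move=> gs Ws; rewrite ttgt_ge //; case: (leqP (dim (tlst s)) m) => h.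
    by rewrite comp_small // tgt_to_id // -(proj2 (seg_small Ws gs) h).
  by rewrite comp_smallr //= dim_tgt_to; lia.
elim/(@seg_ind X m): a => [s gs Ws|s w a gs wm IH /wf_cat[_ _ _ _ [Ws Wa]]].
  exact: base.
by rewrite ttgt_cat // comp_cat ?ge_ttgt // IH // base.
Qed.

Lemma compA m a b c : twf a -> twf b -> twf c ->
  ttgt m a = tsrc m b -> ttgt m b = tsrc m c ->
  tcomp m (tcomp m a b) c = tcomp m a (tcomp m b c).
Proof.
have base s r q : tge m s -> tge m r -> tge m q -> twf s -> twf r -> twf q ->
    tgt_to m (tlst s) = src_to m (thd r) -> tgt_to m (tlst r) = src_to m (thd q) ->
    tcomp m (tcomp m s r) q = tcomp m s (tcomp m r q).
  move=> gs gr gq Ws Wr Wq e1 e2.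
  case: (seg_comp Wr Wq gr gq e2) => [[h1 er ->]|[h1 h2 eq ->]|[h1 h2 e3]].
  - case: (seg_comp Ws Wr gs gr e1) => [[h3 es ->]|[h3 h4 es ->]|[h3 h4]] //.
      by rewrite comp_small // (comp_small _ Ws).
    by move: h4; rewrite ltnNge -(seg_dim Wr gr) h1.
  - case: (seg_comp Ws Wr gs gr e1) => [[h3 es ->]|[h3 h4 es ->]|[h3 h4 ->]] //.
    + exact: comp_smallr.
    + exact: comp_smallr.
    + rewrite comp_smallr ?lst_cat // ge_cat gs gr dim_tgt_to; lia.
  - rewrite e3; case: (seg_comp Ws Wr gs gr e1) => [[h3 es ->]|[h3 h4 es ->]|[h3 h4 ->]].
    + by rewrite e3 comp_small.
    + by move: h4; rewrite -(seg_dim Wr gr) leqNgt h1.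
    + rewrite comp_big ?lst_cat //; last by rewrite ge_cat gs gr dim_tgt_to; lia.
      by rewrite comp_big ?hd_cat // catA.
elim/(@seg_ind X m): a b c => [s gs|s w a gs wm IH] b c Wa Wb Wc.
  case: (segP m b) => [gr|[r [w' [b' [gr h' eb]]]]]; last first.
    by rewrite eb tsrc_cat // ttgt_ge // tsrc_ge.
  case: (segP m c) => [gq|[q [w' [c' [gq h' ec]]]]]; last first.
    by rewrite ec tsrc_cat // (ttgt_ge gr) // (tsrc_ge gq).
  by rewrite !ttgt_ge // !tsrc_ge // => -[e1] [e2]; apply: base.
case: (segP m b) => [gr|[r [w' [b' [gr h' eb]]]]].
  by rewrite ttgt_cat // ttgt_ge // tsrc_ge.
case: (segP m c) => [gq|[q [w'' [c' [gq h'' ec]]]]].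
  by rewrite eb !ttgt_cat // (ttgt_ge gr) (tsrc_ge gq).
subst b c; rewrite !ttgt_cat // !tsrc_cat // (ttgt_ge gs) (ttgt_ge gr) (tsrc_ge gr) (tsrc_ge gq) /= => -[e1 e2 e3] [e4 e5 e6].
move: Wa Wb Wc => /wf_cat[_ _ _ _ [Ws Wa]] /wf_cat[_ _ _ _ [Wr Wb]] /wf_cat[_ _ _ _ [Wq Wc]].
have g1 : tge m (tcomp m s r) by exact: (@ge_comp_seg m).
have g2 : tge m (tcomp m r q) by exact: (@ge_comp_seg m).
by rewrite !comp_cat // base // IH.
Qed.

Lemma comp_cat' m s r w a b : dim w < m -> twf s -> twf r -> ttgt m s = tsrc m r ->
  tcomp m (tcat s w a) (tcat r w b) = tcat (tcomp m s r) w (tcomp m a b).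
Proof.
move=> wm; move: s r; apply: comp_ind => [s r gs gr _ _ _|s r x c d gs gr xm _ _ _ _ _ _ _ _ IH].
  exact: comp_cat.
by rewrite !catA !(comp_cat _ _ gs gr xm xm) IH catA.
Qed.

Lemma interchange j m a b c d : j < m -> twf a -> twf b -> twf c -> twf d ->
  ttgt m a = tsrc m b -> ttgt m c = tsrc m d -> ttgt j a = tsrc j c ->
  tcomp j (tcomp m a b) (tcomp m c d) = tcomp m (tcomp j a c) (tcomp j b d).
Proof.
move=> jm.
have base a' b' c' d' : tge j a' -> tge j b' -> tge j c' -> tge j d' ->
  twf a' -> twf b' -> twf c' -> twf d' ->
  ttgt m a' = tsrc m b' -> ttgt m c' = tsrc m d' -> ttgt j a' = tsrc j c' ->
  tcomp j (tcomp m a' b') (tcomp m c' d') = tcomp m (tcomp j a' c') (tcomp j b' d').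
  move=> ga gb gc gd Wa Wb Wc Wd e1 e2 e3.
  have e1h : minn m (dim (thd a')) = minn m (dim (thd b')).
    by rewrite -dim_hd_ttgt // e1 hd_tsrc dim_src_to.
  have e1l : minn m (dim (tlst a')) = minn m (dim (tlst b')).
    by rewrite -[RHS]dim_lst_tsrc // -e1 lst_ttgt dim_tgt_to.
  have e2h : minn m (dim (thd c')) = minn m (dim (thd d')).
    by rewrite -dim_hd_ttgt // e2 hd_tsrc dim_src_to.
  have e4 : ttgt j b' = tsrc j d'.
    rewrite -(ttgt_tsrc Wb jm) -e1 ttgt_ttgt; last exact: ltnW.
    by rewrite e3 -(tsrc_ttgt Wc jm) e2 tsrc_tsrc // ltnW.
  have eT : tgt_to j (tlst a') = tgt_to j (tlst b').
    by rewrite -(lst_tsrc Wb jm) -e1 lst_ttgt tgt_tgt_to // ltnW.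
  have [iA1 iA2] := tgt_to_eq (lst_comp Wa Wb e1).
  have [iC1 iC2] := src_to_eq (hd_comp Wc Wd e2).
  have WA := wf_comp Wa Wb e1; have WC := wf_comp Wc Wd e2.
  have gA := ge_comp (ltnW jm) Wa Wb e1 ga gb.
  have gC := ge_comp (ltnW jm) Wc Wd e2 gc gd.
  case: (leqP (dim (tlst a')) j) => h1.
    by rewrite (comp_small _ WA gA) ?(comp_small _ Wa ga) ?(comp_small _ Wb gb) //; lia.
  case: (leqP (dim (thd c')) j) => h2.
    by rewrite (comp_smallr gA gC WC) ?(comp_smallr ga gc Wc) ?(comp_smallr gb gd Wd) //; lia.
  rewrite (comp_big gA) ?(comp_big ga) ?(comp_big gb) //; try lia.
  rewrite eT comp_cat' //; last by rewrite dim_tgt_to; lia.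
  by rewrite iA2 // ltnW.
move=> Wa Wb Wc Wd e1 e2 e3.
have e4 : ttgt j b = tsrc j d.
  rewrite -(ttgt_tsrc Wb jm) -e1 ttgt_ttgt; last exact: ltnW.
  by rewrite e3 -(tsrc_ttgt Wc jm) e2 tsrc_tsrc // ltnW.
have e5 : tsrc j a = tsrc j b.
  by rewrite -(tsrc_ttgt Wa jm) e1 tsrc_tsrc // ltnW.
elim/(@seg_ind X j): a b c d Wa Wb Wc Wd e1 e2 e3 e4 e5 => [s gs|s w a gs wj IH] b c d.
  case: (segP j b) => [gb|[sb [wb [b' [gb h1 ->]]]]]; last first.
    by move=> _ _ _ _ _ _ _ _; rewrite tsrc_cat // (tsrc_ge gs) (tsrc_ge gb).
  case: (segP j c) => [gc|[sc [wc [c' [gc h2 ->]]]]]; last first.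
    by move=> _ _ _ _ _ _; rewrite tsrc_cat // (ttgt_ge gs) (tsrc_ge gc).
  case: (segP j d) => [gd|[sd [wd [d' [gd h3 ->]]]]]; last first.
    by move=> _ _ _ _ _ _ _; rewrite tsrc_cat // (ttgt_ge gb) (tsrc_ge gd).
  by move=> *; apply: base.
case: (segP j b) => [gb|[sb [wb [b' [gb h1 ->]]]]].
  by move=> _ _ _ _ _ _ _ _; rewrite tsrc_cat // (tsrc_ge gs) (tsrc_ge gb).
case: (segP j c) => [gc|[sc [wc [c' [gc h2 ->]]]]].
  by move=> _ _ _ _ _ _; rewrite ttgt_cat // (ttgt_ge gs) (tsrc_ge gc).
case: (segP j d) => [gd|[sd [wd [d' [gd h3 ->]]]]].
  by move=> _ _ _ _ _ _ _; rewrite ttgt_cat // (ttgt_ge gb) (tsrc_ge gd).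
move=> /wf_cat[_ _ _ _ [Ws Wa]] /wf_cat[_ _ _ _ [Wsb Wb]].
move=> /wf_cat[_ _ _ _ [Wsc Wc]] /wf_cat[_ _ _ _ [Wsd Wd]].
have lm (x : nat) : x < j -> x < m by lia.
rewrite !ttgt_cat ?lm // !tsrc_cat ?lm //.
have inj p q r x y z : tge j p -> tge j q -> dim x < j -> dim y < j ->
  tcat p x r = tcat q y z -> [/\ p = q, x = y & r = z] by exact: cat_inj.
move=> /inj[]; rewrite ?ge_ttgt ?ge_tsrc // => f1 f2 f3.
move=> /inj[]; rewrite ?ge_ttgt ?ge_tsrc // => f4 f5 f6.
move=> /inj[]; rewrite ?ge_ttgt ?ge_tsrc // => f7 f8 f9.
move=> /inj[]; rewrite ?ge_ttgt ?ge_tsrc // => f10 f11 f12.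
move=> /inj[]; rewrite ?ge_ttgt ?ge_tsrc // => f13 f14 f15.
subst wb wc wd.
have lj : dim w < m by lia.
rewrite (comp_cat' _ _ lj Ws Wsb f1) (comp_cat' _ _ lj Wsc Wsd f4).
rewrite !(comp_cat _ _ _ _ wj wj) //; try exact: (ge_comp (ltnW jm)).
rewrite [RHS](comp_cat' _ _ lj); first by congr (tcat _ w _); [exact: base|exact: IH].
- exact: wf_comp.
- exact: wf_comp.
by rewrite ttgt_comp_gt // tsrc_comp_gt // f1 f4.
Qed.
End Composition.

Record gmap (X Y : gset) := GMap {
  gmap_fun :> forall n, X n -> Y n;
  gmap_src : forall n (x : X n.+1), gmap_fun (src x) = src (gmap_fun x);
  gmap_tgt : forall n (x : X n.+1), gmap_fun (tgt x) = tgt (gmap_fun x) }.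
Arguments gmap_fun {X Y} f {n} x : rename.

Definition gid (X : gset) : gmap X X :=
  @GMap X X (fun n x => x) (fun n x => erefl) (fun n x => erefl).
Definition gcomp (X Y Z : gset) (g : gmap Y Z) (f : gmap X Y) : gmap X Z.
Proof.
by exists (fun n x => g n (f n x)) => n x; rewrite ?gmap_src ?gmap_tgt.
Defined.

Definition gmap_cell (X Y : gset) (f : gmap X Y) (c : gcell X) : gcell Y :=
  gc (f _ (projT2 c)).

(* The cells of TX. *)
Record pd (X : gset) (n : nat) := Pd {
  tab : table (gcell X);
  tab_wf : twf tab;
  tab_dim : tbounded n tab }.

Lemma pd_eq (X : gset) n (d d' : pd X n) : tab d = tab d' -> d = d'.
Proof.
by case: d d' => [t w b] [t' w' b'] /= e; subst t'; congr Pd; apply: proof_irrelevance.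
Qed.

Definition pd_src (X : gset) n (d : pd X n.+1) : pd X n :=
  Pd (wf_tsrc n (tab_wf d)) (bounded_tsrc n (tab d)).
Definition pd_tgt (X : gset) n (d : pd X n.+1) : pd X n :=
  Pd (wf_ttgt n (tab_wf d)) (bounded_ttgt n (tab d)).

Definition Tobj (X : gset) : gset.
Proof.
exists (pd X) (@pd_src X) (@pd_tgt X) => n d; apply: pd_eq => /=.
  by rewrite tsrc_tsrc // tsrc_ttgt //; exact: tab_wf.
by rewrite ttgt_ttgt // ttgt_tsrc //; exact: tab_wf.
Defined.

Section Map.
Context {X Y : gset} (f : gmap X Y).
Notation F := (gmap_cell f).
Implicit Types (u w : gcell X) (t s r a b : table (gcell X)).
Lemma src_to_map m u : src_to m (F u) = F (src_to m u).
Proof.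
case: u => n x; rewrite /src_to /=; elim: n x => //= n IH x.
by case: ifP => // _; rewrite -IH gmap_src.
Qed.
Lemma tgt_to_map m u : tgt_to m (F u) = F (tgt_to m u).
Proof.
case: u => n x; rewrite /tgt_to /=; elim: n x => //= n IH x.
by case: ifP => // _; rewrite -IH gmap_tgt.
Qed.
Lemma hd_map t : thd (tmap F t) = F (thd t). Proof. by case: t. Qed.
Lemma lst_map t : tlst (tmap F t) = F (tlst t). Proof. by elim: t. Qed.
Lemma set_hd_map x t : tset_hd (F x) (tmap F t) = tmap F (tset_hd x t).
Proof. by case: t. Qed.
Lemma cat_map s w t : tmap F (tcat s w t) = tcat (tmap F s) (F w) (tmap F t).
Proof. by elim: s => //= u w' s ->. Qed.
Lemma ge_map m t : tge m (tmap F t) = tge m t.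
Proof. by elim: t => //= u w t ->. Qed.
Lemma bounded_map n t : tbounded n t -> tbounded n (tmap F t).
Proof. by elim: t => //= u w t IH [h /IH]. Qed.
Lemma wf_map t : twf t -> twf (tmap F t).
Proof.
elim: t => //= u w t IH [h1 h2 h3 h4 /IH h5].
by rewrite hd_map tgt_to_map src_to_map; split=> //; rewrite ?h3 ?h4.
Qed.
Lemma tsrc_map m t : tsrc m (tmap F t) = tmap F (tsrc m t).
Proof. by elim: t => [u|u w t IH] /=; rewrite src_to_map // IH; case: ifP => // _; rewrite set_hd_map. Qed.
Lemma ttgt_map m t : ttgt m (tmap F t) = tmap F (ttgt m t).
Proof. by elim: t => [u|u w t IH] /=; rewrite tgt_to_map // IH; case: ifP. Qed.
Lemma join_map m u r : tjoin m (F u) (tmap F r) = tmap F (tjoin m u r).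
Proof.
rewrite /tjoin hd_map set_hd_map tgt_to_map.
by rewrite -[dim (F u)]/(dim u) -[dim (F (thd r))]/(dim (thd r)); do 2![case: ifP => // _].
Qed.
Lemma comp_map m a b : tcomp m (tmap F a) (tmap F b) = tmap F (tcomp m a b).
Proof.
elim: a b => [u|u w a IH] b /=; first exact: join_map.
rewrite IH /dim; case: ifP => // _.
rewrite -join_map; congr tjoin.
by elim: b => //= v w' b IHb; rewrite IHb IH /dim; case: ifP.
Qed.
End Map.

Definition Tmap (X Y : gset) (f : gmap X Y) : gmap (Tobj X) (Tobj Y).
Proof.
exists (fun n (d : Tobj X n) => Pd (wf_map f (tab_wf d)) (bounded_map f (tab_dim d)) : Tobj Y n).
- by move=> n d; apply: pd_eq; rewrite /= tsrc_map.
- by move=> n d; apply: pd_eq; rewrite /= ttgt_map.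
Defined.

Lemma one_bd (X : gset) n (x : X n) : tbounded n (One (gc x)).
Proof. exact: leqnn. Qed.
Definition Teta (X : gset) : gmap X (Tobj X).
Proof.
exists (fun n (x : X n) => Pd (tab := One (gc x)) I (one_bd x) : Tobj X n).
- move=> n x; apply: pd_eq; rewrite /= /src_to /= ltnn.
  by congr One; case: n x => //= n x; rewrite leqnn.
- move=> n x; apply: pd_eq; rewrite /= /tgt_to /= ltnn.
  by congr One; case: n x => //= n x; rewrite leqnn.
Defined.

(* The segments of t between its lower-row entries of dimension <= m. *)
Fixpoint tsegs (X : gset) m (t : table (gcell X)) : table (gcell X) * seq (table (gcell X)) :=
  match t with
  | One u => (One u, [::])
  | Cons u w t' =>
      let: (s, ss) := tsegs m t' in
      if dim w <= m then (One u, s :: ss) else (Cons u w s, ss)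
  end.
Fixpoint tcompseq (X : gset) m (t : table (gcell X)) ts :=
  match ts with [::] => t | t' :: ts' => tcomp m t (tcompseq m t' ts') end.
Definition entry (X : gset) (c : gcell (Tobj X)) : table (gcell X) := tab (projT2 c).
(* Gluing of a pasting diagram of pasting diagrams whose lower-row entries have
   dimension >= m and whose upper-row entries have dimension <= m + d: cut at the
   lower-row entries of dimension m, glue each segment, and compose the results
   along dimension m. *)
Fixpoint glue (X : gset) d m (t : table (gcell (Tobj X))) : table (gcell X) :=
  match d with
  | 0 => entry (thd t)
  | d'.+1 => let: (s, ss) := tsegs m t in
             tcompseq m (glue d' m.+1 s) (map (glue d' m.+1) ss)
  end.

Lemma segs_ge (X : gset) m (t : table (gcell X)) : tge m.+1 t -> tsegs m t = (t, [::]).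
Proof. by elim: t => //= u w t IH /andP[h /IH->]; rewrite leqNgt h. Qed.
Lemma segs_cat (X : gset) m s w (t : table (gcell X)) : tge m.+1 s -> dim w <= m ->
  tsegs m (tcat s w t) = (s, (tsegs m t).1 :: (tsegs m t).2).
Proof.
move=> + h; elim: s => [u|u w' s IH] /=; first by case: (tsegs m t) => ? ?; rewrite h.
by case/andP=> h' /IH->; rewrite leqNgt h'.
Qed.

Section Glue.
Context {X : gset}.
Implicit Types (c : gcell (Tobj X)) (t s r a b : table (gcell (Tobj X))).
Lemma glue1 d m t : tge m.+1 t -> glue d.+1 m t = glue d m.+1 t.
Proof. by move=> /= /segs_ge->. Qed.
Lemma glue2 d m s w t : tge m.+1 s -> dim w <= m ->
  glue d.+1 m (tcat s w t) = tcomp m (glue d m.+1 s) (glue d.+1 m t).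
Proof. by move=> g h /=; rewrite segs_cat //=; case: (tsegs m t). Qed.
Lemma glue_One d m c : glue d m (One c) = entry c.
Proof. by elim: d m => //= d IH m; rewrite IH. Qed.

Lemma entry_src m c : entry (src_to m c) = tsrc m (entry c).
Proof.
case: c => n x; rewrite /src_to /entry /=; elim: n x => [|n IH] x /=.
  by rewrite tsrc_id //; [exact: tab_wf|apply: bounded_le (tab_dim x)].
case: ifP => h /=; last by rewrite IH /= tsrc_tsrc //; lia.
by rewrite tsrc_id //; [exact: tab_wf|apply: bounded_le (tab_dim x)].
Qed.
Lemma entry_tgt m c : entry (tgt_to m c) = ttgt m (entry c).
Proof.
case: c => n x; rewrite /tgt_to /entry /=; elim: n x => [|n IH] x /=.
  by rewrite ttgt_id //; [exact: tab_wf|apply: bounded_le (tab_dim x)].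
case: ifP => h /=; last by rewrite IH /= ttgt_ttgt //; lia.
by rewrite ttgt_id //; [exact: tab_wf|apply: bounded_le (tab_dim x)].
Qed.
Lemma wf_entry c : twf (entry c). Proof. exact: tab_wf. Qed.
Lemma bounded_entry c : tbounded (dim c) (entry c). Proof. exact: tab_dim. Qed.

Lemma ge_bd_One m t : twf t -> tge m t -> tbounded m t -> t = One (thd t).
Proof. by case: t => //= u w t [h _ _ _ _] /andP[g _] []; lia. Qed.

Definition lev d m t := [/\ twf t, tge m t & tbounded (m + d) t].
Lemma lev_ind (P : nat -> nat -> table (gcell (Tobj X)) -> Prop) :
  (forall m c, dim c <= m -> P 0 m (One c)) ->
  (forall d m t, lev d m.+1 t -> P d m.+1 t -> P d.+1 m t) ->
  (forall d m s w t, dim w = m -> m < dim (tlst s) -> m < dim (thd t) ->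
     tgt_to m (tlst s) = w -> src_to m (thd t) = w ->
     lev d m.+1 s -> lev d.+1 m t -> P d m.+1 s -> P d.+1 m t ->
     P d.+1 m (tcat s w t)) ->
  forall d m t, lev d m t -> P d m t.
Proof.
move=> h0 h1 h2; elim=> [|d IH] m t [W g b].
  by move: b; rewrite addn0 => b; move: (b); rewrite (ge_bd_One W g b); exact: h0.
elim/(@seg_ind (Tobj X) m.+1): t W g b => [s gs W g b|s w t gs wm IHt].
  have L : lev d m.+1 s by split=> //; rewrite addSnnS.
  by apply: h1 => //; exact: IH.
move=> /wf_cat[k1 k2 k3 k4 [Ws Wt]]; rewrite ge_cat => /and3P[g1 g2 g3] /bounded_cat[b1 b2].
have e : dim w = m by lia.
have L : lev d m.+1 s by split=> //; rewrite addSnnS.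
subst m; apply: h2 => //.
- exact: IH.
- exact: IHt.
Qed.

Lemma glue_basic d m t : lev d m t ->
  twf (glue d m t) /\ forall k, k <= m ->
    tsrc k (glue d m t) = tsrc k (entry (thd t)) /\
    ttgt k (glue d m t) = ttgt k (entry (tlst t)).
Proof.
move: d m t; apply: lev_ind => [m c _|d m t L [W h]|d m s w t e l1 l2 et es Ls Lt [Ws hs] [Wt ht]].
- by split=> //; exact: wf_entry.
- have [_ G _] := L; rewrite -glue1 // in W h *; split=> // k km; apply: h; lia.
- have [_ G _] := Ls; rewrite glue2 //; last lia.
  have M : ttgt m (glue d m.+1 s) = tsrc m (glue d.+1 m t).
    by rewrite (proj2 (hs _ _)) // (proj1 (ht _ _)) // -entry_tgt -entry_src et es.
  split; first exact: wf_comp.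
  move=> k km; rewrite hd_cat lst_cat.
  rewrite -(tsrc_tsrc _ km) tsrc_comp // tsrc_tsrc // (proj1 (hs _ _)) //; last lia.
  by rewrite -(ttgt_ttgt _ km) ttgt_comp // ttgt_ttgt // (proj2 (ht _ _)).
Qed.
Lemma wf_glue d m t : lev d m t -> twf (glue d m t).
Proof. by case/glue_basic. Qed.
Lemma tsrc_glue_le d m t k : lev d m t -> k <= m ->
  tsrc k (glue d m t) = tsrc k (entry (thd t)).
Proof. by case/glue_basic=> _ h /h[]. Qed.
Lemma ttgt_glue_le d m t k : lev d m t -> k <= m ->
  ttgt k (glue d m t) = ttgt k (entry (tlst t)).
Proof. by case/glue_basic=> _ h /h[]. Qed.
Lemma glue_match d m s w t : lev d m.+1 s -> lev d.+1 m t ->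
  tgt_to m (tlst s) = w -> src_to m (thd t) = w ->
  ttgt m (glue d m.+1 s) = tsrc m (glue d.+1 m t).
Proof.
by move=> L1 L2 e1 e2; rewrite ttgt_glue_le // tsrc_glue_le // -entry_tgt -entry_src e1 e2.
Qed.

Lemma tsrc_glue d m t k : lev d m t -> tsrc k (glue d m t) = glue d m (tsrc k t).
Proof.
move=> L; move: (L); elim/lev_ind: {d m} t / L => [m c _|d m t L IH|d m s w t e l1 l2 et es Ls Lt IHs IHt] L'.
- by rewrite /= entry_src.
- have [_ G _] := L; by rewrite !glue1 ?ge_tsrc // IH.
case: (leqP k m) => km.
  have [_ G _] := L'; rewrite tsrc_glue_le // [X in glue _ _ X]tsrc_ge ?glue_One ?entry_src //; exact: (ge_le km).
have [Ws G _] := Ls; have [Wt _ _] := Lt.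
rewrite tsrc_cat ?e // !glue2 ?ge_tsrc ?e //.
by rewrite tsrc_comp_gt ?IHs ?IHt //; [exact: wf_glue|exact: wf_glue|exact: glue_match Lt et es].
Qed.
Lemma ttgt_glue d m t k : lev d m t -> ttgt k (glue d m t) = glue d m (ttgt k t).
Proof.
move=> L; move: (L); elim/lev_ind: {d m} t / L => [m c _|d m t L IH|d m s w t e l1 l2 et es Ls Lt IHs IHt] L'.
- by rewrite /= entry_tgt.
- have [_ G _] := L; by rewrite !glue1 ?ge_ttgt // IH.
case: (leqP k m) => km.
  have [_ G _] := L'; rewrite ttgt_glue_le // [X in glue _ _ X]ttgt_ge ?glue_One ?entry_tgt //; exact: (ge_le km).
have [Ws G _] := Ls; have [Wt _ _] := Lt.
rewrite ttgt_cat ?e // !glue2 ?ge_ttgt ?e //.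
by rewrite ttgt_comp_gt ?IHs ?IHt //; [exact: wf_glue|exact: wf_glue|exact: glue_match Lt et es].
Qed.

Lemma glueS d m t : lev d m t -> glue d.+1 m t = glue d m t.
Proof.
move=> L; elim/lev_ind: {d m} t / L => [m c _|d m t L IH|d m s w t e l1 l2 et es Ls Lt IHs IHt].
- by rewrite glue_One.
- by have [_ G _] := L; rewrite glue1 // IH -glue1.
- by have [_ G _] := Ls; rewrite !glue2 ?e // IHs IHt.
Qed.
Lemma lev_leq d d' m t : d <= d' -> lev d m t -> lev d' m t.
Proof. by move=> h [W g b]; split=> //; apply: bounded_le b; lia. Qed.
Lemma glue_leq d d' m t : lev d m t -> d <= d' -> glue d' m t = glue d m t.
Proof.
move=> L; elim: d' => [|d' IH] h; first by move: h; case: (d).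
case: (ltnP d' d) => h'; first by have -> : d = d'.+1 by lia.
by rewrite glueS ?IH //; exact: lev_leq L.
Qed.
End Glue.

Section Glue2.
Context {X : gset}.
Implicit Types (c : gcell (Tobj X)) (t s r a b : table (gcell (Tobj X))).

Lemma lev_cat d m s w t : tge m.+1 s -> dim w <= m -> lev d.+1 m (tcat s w t) ->
  [/\ lev d m.+1 s, lev d.+1 m t, dim w = m, tgt_to m (tlst s) = w & src_to m (thd t) = w].
Proof.
move=> gs h [/wf_cat[k1 k2 k3 k4 [Ws Wt]]].
rewrite ge_cat => /and3P[g1 g2 g3] /bounded_cat[b1 b2].
have e : dim w = m by lia.
by split; rewrite -?e //; split; rewrite // -?e ?e ?addSnnS.
Qed.
Lemma lev1 d m s : tge m.+1 s -> lev d.+1 m s -> lev d m.+1 s.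
Proof. by move=> g [W _ b]; split; rewrite // addSnnS. Qed.

Lemma tsrc_entry m c : dim c <= m -> tsrc m (entry c) = entry c.
Proof. by move=> h; rewrite -entry_src src_to_id. Qed.

Lemma glue_comp d j m a b : lev d j a -> lev d j b -> j <= m ->
  ttgt m a = tsrc m b -> glue d j (tcomp m a b) = tcomp m (glue d j a) (glue d j b).
Proof.
elim: d j a b => [|d IH] j a b.
  move=> [Wa ga]; rewrite addn0 => ba [Wb gb]; rewrite addn0 => bb jm.
  move: (ba) (bb); rewrite (ge_bd_One Wa ga ba) (ge_bd_One Wb gb bb) /= => h1 h2.
  have h1' := leq_trans h1 jm; have h2' := leq_trans h2 jm.
  rewrite tgt_to_id // src_to_id // => -[->]; rewrite /tjoin h2' /=.
  by rewrite -[X in tcomp m X _](tsrc_entry h2') comp_src //; exact: wf_entry.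
move=> La Lb; rewrite leq_eqVlt => /orP[/eqP e|jm].
  subst j; have [Wa ga ba] := La; have [Wb gb bb] := Lb.
  rewrite ttgt_ge // tsrc_ge // => -[e].
  have [WA WB] := (wf_glue La, wf_glue Lb).
  case: (seg_comp Wa Wb ga gb e) => [[h ea ->]|[h1 h2 eb ->]|[h1 h2 ->]].
  - by rewrite {1}ea glue_One entry_src -(tsrc_glue_le Lb) // comp_src.
  - by rewrite {1}eb glue_One entry_tgt -(ttgt_glue_le La) // comp_tgt.
  have [w ew] : exists w, src_to m (thd b) = w by eexists.
  have dw : dim w = m by rewrite -ew dim_src_to; lia.
  rewrite e ew; rewrite ew in e.
  elim/(@seg_ind (Tobj X) m.+1): a La Wa ga ba e WA h1 => [s gs|s w' a gs h IHa] La Wa ga ba e WA h1.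
    by rewrite glue2 ?dw // -glue1.
  have [Ls La' ew' e1 e2] := lev_cat gs h La; have [Wa' ga' ba'] := La'.
  have [k1 k2 k3 k4 [Ws _]] := proj1 (wf_cat _ _ _) Wa.
  rewrite lst_cat in h1 e.
  rewrite catA !(glue2 _ _ gs h) IHa //; last exact: wf_glue.
  rewrite compA //; try exact: wf_glue.
    exact: glue_match La' e1 e2.
  by rewrite ttgt_glue_le // (tsrc_glue_le Lb) // -entry_tgt -entry_src e ew.
have lm (x : nat) : x <= j -> x < m by lia.
elim/(@seg_ind (Tobj X) j.+1): a b La Lb => [s gs|s w a gs wj IHa] b La Lb.
  case: (segP j.+1 b) => [gb|[r [w [b' [gr h eb]]]]].
    move=> e; have [[Ws _ _] [Wb _ _]] := (La, Lb).
    rewrite !glue1 ?IH //; try exact: lev1.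
    by apply: ge_comp.
  rewrite eb tsrc_cat ?lm // => e.
  have := congr1 (tge j.+1) e.
  by rewrite ge_cat ge_ttgt // [j < dim w]ltnNge -ltnS h /= andbF.
case: (segP j.+1 b) => [gb|[r [w' [b' [gr h eb]]]]].
  rewrite ttgt_cat ?lm // => e; have := congr1 (tge j.+1) e.
  by rewrite ge_cat (ge_tsrc _ gb) [j < dim w]ltnNge -ltnS wj /= andbF.
subst b; rewrite ttgt_cat ?lm // tsrc_cat ?lm //.
move=> /(cat_inj (ge_ttgt _ gs) (ge_tsrc _ gr) wj h)[f1 f2 f3]; subst w'.
have [Ls La' ew e1 e2] := lev_cat gs wj La.
have [Lr Lb' _ e3 e4] := lev_cat gr h Lb.
have [[Ws _ _] [Wr _ _]] := (Ls, Lr); have [[Wa _ _] [Wb _ _]] := (La', Lb').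
have wm : dim w < m by exact: lm.
rewrite comp_cat' // !(glue2 _ _ _ wj) //; last exact: ge_comp.
rewrite IHa // IH //.
have M1 : ttgt m (glue d j.+1 s) = tsrc m (glue d j.+1 r).
  by rewrite ttgt_glue // tsrc_glue // f1.
have M2 : ttgt m (glue d.+1 j a) = tsrc m (glue d.+1 j b').
  by rewrite ttgt_glue // tsrc_glue // f3.
rewrite interchange //; try exact: wf_glue.
exact: glue_match La' e1 e2.
Qed.

Lemma glue_unit d m (t : table (gcell X)) : twf t -> tge m t -> tbounded (m + d) t ->
  glue d m (tmap (gmap_cell (Teta X)) t) = t.
Proof.
elim: d m t => [|d IH] m t W g.
  by case: t W g => [[n x]|u w t] //= [h _ _ _ _] /andP[g _] []; lia.
elim/(@seg_ind X m.+1): t W g => [s gs|s w t gs wm IHt] W g b.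
  by rewrite glue1 ?ge_map // IH // addSnnS.
move: W g b => /wf_cat[k1 k2 k3 k4 [Ws Wt]].
rewrite ge_cat => /and3P[g1 g2 g3] /bounded_cat[b1 b2].
have e : dim w = m by lia.
rewrite cat_map glue2 ?ge_map // IH //; last by rewrite addSnnS.
by rewrite IHt // comp_big // -?e // k3.
Qed.
End Glue2.

Lemma glue_map (X Y : gset) (f : gmap X Y) d m (t : table (gcell (Tobj X))) :
  glue d m (tmap (gmap_cell (Tmap f)) t) = tmap (gmap_cell f) (glue d m t).
Proof.
elim: d m t => [|d IH] m t; first by rewrite /= hd_map.
elim/(@seg_ind (Tobj X) m.+1): t => [s gs|s w t gs wm IHt].
  by rewrite !glue1 ?ge_map.
by rewrite cat_map !glue2 ?ge_map // IH IHt comp_map.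
Qed.

Lemma lev_tab (X : gset) n (z : Tobj (Tobj X) n) : lev n 0 (tab z).
Proof.
by split; [exact: tab_wf|elim: (tab z) => //= ? ? ? ->|exact: tab_dim].
Qed.

Lemma bounded_glue (X : gset) n (z : Tobj (Tobj X) n) : tbounded n (glue n 0 (tab z)).
Proof.
rewrite -(tsrc_id (tab_wf z) (tab_dim z)) -(tsrc_glue _ (lev_tab z)).
exact: bounded_tsrc.
Qed.

Definition Tmu (X : gset) : gmap (Tobj (Tobj X)) (Tobj X).
Proof.
exists (fun n (z : Tobj (Tobj X) n) => Pd (wf_glue (lev_tab z)) (bounded_glue z) : Tobj X n).
- move=> n z; apply: pd_eq => /=; rewrite (tsrc_glue _ (lev_tab z)).
  by rewrite -(glue_leq (lev_tab (src z)) (leqnSn n)).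
- move=> n z; apply: pd_eq => /=; rewrite (ttgt_glue _ (lev_tab z)).
  by rewrite -(glue_leq (lev_tab (tgt z)) (leqnSn n)).
Defined.

Lemma glue_glue (X : gset) N d m (t : table (gcell (Tobj (Tobj X)))) : lev d m t -> m + d <= N ->
  glue N 0 (glue d m t) = glue d m (tmap (gmap_cell (Tmu X)) t).
Proof.
move=> L; elim/(@lev_ind (Tobj X)): {d m} t / L => [m c h|d m t L IH|d m s w t e l1 l2 et es Ls Lt IHs IHt] mN.
- by case: c h => n z h; apply: (glue_leq (lev_tab z)); rewrite /dim /= in h; lia.
- by have [_ G _] := L; rewrite !glue1 ?ge_map // IH //; lia.
have [Ws G bs] := Ls; have [Wt Gt bt] := Lt.
rewrite cat_map !glue2 ?ge_map ?e //.
have lg d' m' (r : table (gcell (Tobj (Tobj X)))) : lev d' m' r -> m' + d' <= N -> lev N 0 (glue d' m' r).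
  move=> L h; split; first exact: wf_glue.
    by elim: (glue d' m' r) => //= ? ? ? ->.
  have [Wr _ br] := L.
  rewrite -(tsrc_id Wr (bounded_le h br)) -tsrc_glue //.
  exact: bounded_tsrc.
rewrite glue_comp ?IHs ?IHt //; try lia; try (apply: lg => //; lia).
- exact: glue_match Lt et es.
- by rewrite -e.
Qed.

(* Endofunctors of and monads on GSet; equality of morphisms of globular sets
   is expressed cellwise. *)
Record gfunctor := GFunctor {
  fobj :> gset -> gset;
  fmap : forall X Y : gset, gmap X Y -> gmap (fobj X) (fobj Y);
  fmap_id : forall X n (x : fobj X n), fmap (gid X) n x = x;
  fmap_comp : forall X Y Z (g : gmap Y Z) (f : gmap X Y) n (x : fobj X n),
    fmap (gcomp g f) n x = fmap g n (fmap f n x) }.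
Arguments fmap g {X Y} f : rename.

Record monad := Monad {
  mfun :> gfunctor;
  eta : forall X, gmap X (mfun X);
  mu : forall X, gmap (mfun (mfun X)) (mfun X);
  eta_nat : forall X Y (f : gmap X Y) n (x : X n),
    fmap mfun f n (eta X n x) = eta Y n (f n x);
  mu_nat : forall X Y (f : gmap X Y) n (x : mfun (mfun X) n),
    fmap mfun f n (mu X n x) = mu Y n (fmap mfun (fmap mfun f) n x);
  mu_eta : forall X n (x : mfun X n), mu X n (eta (mfun X) n x) = x;
  mu_fmap_eta : forall X n (x : mfun X n), mu X n (fmap mfun (eta X) n x) = x;
  mu_mu : forall X n (x : mfun (mfun (mfun X)) n),
    mu X n (mu (mfun X) n x) = mu X n (fmap mfun (mu X) n x) }.
Arguments eta m X : rename.
Arguments mu m X : rename.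

Record monad_map (P Q : monad) := MonadMap {
  mmap :> forall X, gmap (P X) (Q X);
  mmap_nat : forall X Y (f : gmap X Y) n (x : P X n),
    mmap Y n (fmap P f n x) = fmap Q f n (mmap X n x);
  mmap_eta : forall (X : gset) n (x : X n), mmap X n (eta P X n x) = eta Q X n x;
  mmap_mu : forall X n (x : P (P X) n),
    mmap X n (mu P X n x) = mu Q X n (mmap (Q X) n (fmap P (mmap X) n x)) }.

Lemma tmap_ext A B (f g : A -> B) t : (forall x, f x = g x) -> tmap f t = tmap g t.
Proof. by move=> e; elim: t => /= [u|u w t ->]; rewrite !e. Qed.
Lemma tmap_comp A B C (g : B -> C) (f : A -> B) t :
  tmap (fun x => g (f x)) t = tmap g (tmap f t).
Proof. by elim: t => //= u w t ->. Qed.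
Lemma tmap_id A (t : table A) : tmap (fun x => x) t = t.
Proof. by elim: t => //= u w t ->. Qed.

Definition Tfun : gfunctor.
Proof.
exists Tobj Tmap.
- move=> X n d; apply: pd_eq => /=; rewrite -[RHS]tmap_id.
  by apply: tmap_ext => -[].
- by move=> X Y Z g f n d; apply: pd_eq; rewrite /= -tmap_comp.
Defined.

Definition T : monad.
Proof.
exists Tfun Teta Tmu.
- by move=> X Y f n x; apply: pd_eq.
- by move=> X Y f n z; apply: pd_eq; rewrite /= -glue_map.
- by move=> X n d; apply: pd_eq; rewrite /= glue_One.
- move=> X n d; apply: pd_eq; rewrite /= glue_unit //; first exact: tab_wf.
    by elim: (tab d) => //= ? ? ? ->.
  exact: tab_dim.
- by move=> X n z; apply: pd_eq; exact: (glue_glue (lev_tab z)).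
Defined.

Definition gone : gset :=
  @GSet (fun _ => unit) (fun _ _ => tt) (fun _ _ => tt)
    (fun _ _ => erefl) (fun _ _ => erefl).
Definition bang (X : gset) : gmap X gone :=
  @GMap X gone (fun _ _ => tt) (fun _ _ => erefl) (fun _ _ => erefl).

Definition parallel (X : gset) (n : nat) : X n -> X n -> Prop :=
  match n with
  | 0 => fun _ _ => True
  | n'.+1 => fun x y => src x = src y /\ tgt x = tgt y
  end.

Lemma parallel_refl (X : gset) n (x : X n) : parallel x x.
Proof. by case: n x. Qed.

(* Limits in the presheaf category GSet are computed cellwise. *)
Definition is_pullback (A B C D : gset)
    (p : gmap A B) (q : gmap A C) (f : gmap B D) (g : gmap C D) : Prop :=
  (forall n (a : A n), f n (p n a) = g n (q n a)) /\
  (forall n (b : B n) (c : C n), f n b = g n c ->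
     exists! a : A n, p n a = b /\ q n a = c).

(* A morphism from the boundary of the (n+1)-globe to [cmonad gone] is a parallel
   pair (phi, phi') of n-cells, so the commutation of ar_1 o u = v o iota splits
   into its source and target halves. *)
Record contracted_monad := ContractedMonad {
  cmonad :> monad;
  ar : monad_map cmonad T;
  ar_cartesian : forall (X Y : gset) (f : gmap X Y),
    is_pullback (ar X) (fmap cmonad f) (fmap T f) (ar Y);
  kappa : forall n (phi phi' : cmonad gone n) (k : T gone n.+1),
    parallel phi phi' -> ar gone n phi = src k -> ar gone n phi' = tgt k ->
    cmonad gone n.+1;
  kappa_src : forall n phi phi' k par h h', src (@kappa n phi phi' k par h h') = phi;
  kappa_tgt : forall n phi phi' k par h h', tgt (@kappa n phi phi' k par h h') = phi';
  ar_kappa : forall n phi phi' k par h h',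
    ar gone n.+1 (@kappa n phi phi' k par h h') = k }.
Arguments kappa c {n} phi phi' k par h h' : rename.

Record contracted_map (P Q : contracted_monad) := ContractedMap {
  cmap :> monad_map P Q;
  cmap_ar : forall X n (x : P X n), ar Q X n (cmap X n x) = ar P X n x;
  cmap_kappa : forall n (phi phi' : P gone n) k par h h' par1 h1 h1',
    cmap gone n.+1 (kappa P phi phi' k par h h') =
    kappa Q (cmap gone n phi) (cmap gone n phi') k par1 h1 h1' }.

Definition is_initial (L : contracted_monad) : Prop :=
  forall Q : contracted_monad,
    inhabited (contracted_map L Q) /\
    forall (alpha beta : contracted_map L Q) X n (x : L X n),
      alpha X n x = beta X n x.

Record algebra (P : monad) := Algebra {
  carrier :> gset;
  act : gmap (P carrier) carrier;
  act_eta : forall n (x : carrier n), act n (eta P carrier n x) = x;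
  act_mu : forall n (x : P (P carrier) n),
    act n (mu P carrier n x) = act n (fmap P act n x) }.
Arguments act {P} a : rename.

Lemma T1_cell_eq (u v : gcell gone) : dim u = dim v -> u = v.
Proof. by case: u v => [n []] [m []]; rewrite /dim /= => ->. Qed.
Lemma T1_src_tgt n (k : T gone n.+1) : src k = tgt k.
Proof.
apply: pd_eq => /=; have := tab_wf k.
elim/(@seg_ind gone n): (tab k) => [s gs W|s w t gs wm IH /wf_cat[_ _ _ _ [W /IH{}IH]]].
  rewrite tsrc_ge // ttgt_ge //; congr One; apply: T1_cell_eq.
  by rewrite dim_src_to dim_tgt_to seg_min.
rewrite tsrc_cat // ttgt_cat // IH (tsrc_ge gs) (ttgt_ge gs); congr (tcat (One _) w _).
by apply: T1_cell_eq; rewrite dim_src_to dim_tgt_to seg_min.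
Qed.
Lemma T1_dim0 (k : T gone 0) : k = eta T gone 0 tt.
Proof.
apply: pd_eq; case: k => [[u|u w t] /= W b].
  by congr One; apply: T1_cell_eq; move: b; rewrite /dim /=; lia.
by case: W b => h _ _ _ _ []; lia.
Qed.

Section StandardPasting.
Context (L : contracted_monad).

Definition e_cell n : L gone n := eta L gone n tt.
Lemma ar_e_cell n : ar L gone n (e_cell n) = eta T gone n tt.
Proof. exact: mmap_eta. Qed.

(* sp(k), together with the fact that its arity is k, which the recursion needs. *)
Fixpoint sp_sig n : forall k : T gone n, {phi : L gone n | ar L gone n phi = k} :=
  match n with
  | 0 => fun k => exist _ (e_cell 0) (etrans (ar_e_cell 0) (esym (T1_dim0 k)))
  | n'.+1 => fun k =>
      match excluded_middle_informative (k = eta T gone n'.+1 tt) with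
      | left e => exist _ (e_cell n'.+1) (etrans (ar_e_cell n'.+1) (esym e))
      | right _ =>
          let: exist phi h := sp_sig (src k) in
          exist _ (kappa L phi phi k (parallel_refl phi) h (etrans h (T1_src_tgt k)))
            (ar_kappa _ _ _)
      end
  end.
Definition sp n (k : T gone n) : L gone n := sval (sp_sig k).
Lemma ar_sp n (k : T gone n) : ar L gone n (sp k) = k.
Proof. exact: svalP (sp_sig k). Qed.

(* The cell (phi, d) of LX, where LX is regarded as the pullback of T! and ar. *)
Definition lpair (X : gset) n (phi : L gone n) (d : T X n)
    (h : fmap T (bang X) n d = ar L gone n phi) : L X n :=
  proj1_sig (constructive_indefinite_description _
    (proj2 (ar_cartesian L (bang X)) n d phi h)).
End StandardPasting.

Lemma lpairP (L : contracted_monad) (X : gset) n (phi : L gone n) (d : T X n) h :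
  ar L X n (lpair h) = d /\ fmap L (bang X) n (lpair (phi := phi) (d := d) h) = phi.
Proof. by rewrite /lpair; case: constructive_indefinite_description => z []. Qed.

Lemma lpair_uniq (L : contracted_monad) (X : gset) n (phi : L gone n) (d : T X n)
    (h : fmap T (bang X) n d = ar L gone n phi) (z : L X n) :
  ar L X n z = d -> fmap L (bang X) n z = phi -> z = lpair h.
Proof.
move=> e1 e2; have [a [_ u]] := proj2 (ar_cartesian L (bang X)) n d phi h.
by rewrite -(u z) // (u _ (lpairP h)).
Qed.
Lemma sp_globe (L : contracted_monad) n : sp L (eta T gone n tt) = e_cell L n.
Proof. by case: n => //= n; rewrite /sp /=; case: excluded_middle_informative. Qed.
Lemma sp_kappa (L : contracted_monad) n (k : T gone n.+1) : k <> eta T gone n.+1 tt ->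
  exists par h h', sp L k = kappa L (sp L (src k)) (sp L (src k)) k par h h'.
Proof.
move=> nk; have [s es] : exists s, sp L k = s by eexists.
rewrite es; move: es; rewrite {1}/sp; cbn [sp_sig].
case: (excluded_middle_informative (k = eta T gone n.+1 tt)) => [//|ne].
rewrite /sp; case: (sp_sig L (src k)) => phi h /= <-.
by exists (parallel_refl phi), h, (etrans h (T1_src_tgt k)).
Qed.
Lemma src_eta (P : monad) n : src (eta P gone n.+1 tt) = eta P gone n tt.
Proof. exact: esym (gmap_src (eta P gone) (tt : gone n.+1)). Qed.
Lemma tgt_eta (P : monad) n : tgt (eta P gone n.+1 tt) = eta P gone n tt.
Proof. exact: esym (gmap_tgt (eta P gone) (tt : gone n.+1)). Qed.
Lemma src_sp (L : contracted_monad) n (k : T gone n.+1) : src (sp L k) = sp L (src k).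
Proof.
case: (classic (k = eta T gone n.+1 tt)) => [->|/(@sp_kappa L)[par [h [h' ->]]]].
  by rewrite src_eta !sp_globe /e_cell src_eta.
exact: kappa_src.
Qed.
Lemma tgt_sp (L : contracted_monad) n (k : T gone n.+1) : tgt (sp L k) = sp L (tgt k).
Proof.
rewrite -T1_src_tgt.
case: (classic (k = eta T gone n.+1 tt)) => [->|/(@sp_kappa L)[par [h [h' ->]]]].
  by rewrite src_eta !sp_globe /e_cell tgt_eta.
exact: kappa_tgt.
Qed.

Section WeakCategory.
Context {L : contracted_monad} {X : algebra L}.

(* xi(sp(k), d) for a pasting diagram d of shape k in X. *)
Definition paste n (d : T X n) : X n :=
  act X n (lpair (esym (ar_sp L (fmap T (bang X) n d)))).

Lemma src_paste n (d : T X n.+1) : src (paste d) = paste (src d).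
Proof.
rewrite /paste -gmap_src; congr (act X n _); apply: lpair_uniq.
  by rewrite gmap_src (proj1 (lpairP _)).
by rewrite gmap_src (proj2 (lpairP _)) src_sp -gmap_src.
Qed.
Lemma tgt_paste n (d : T X n.+1) : tgt (paste d) = paste (tgt d).
Proof.
rewrite /paste -gmap_tgt; congr (act X n _); apply: lpair_uniq.
  by rewrite gmap_tgt (proj1 (lpairP _)).
by rewrite gmap_tgt (proj2 (lpairP _)) tgt_sp -gmap_tgt.
Qed.
Lemma paste_eta n (x : X n) : paste (eta T X n x) = x.
Proof.
rewrite -[RHS]act_eta /paste; congr (act X n _); symmetry; apply: lpair_uniq.
  by rewrite mmap_eta.
by rewrite !eta_nat sp_globe.
Qed.

Definition id_diagram n (x : X n) : T X n.+1 :=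
  @Pd X n.+1 (One (gc x)) I (leqnSn n).
Definition idc n (x : X n) : X n.+1 := paste (id_diagram x).

Lemma comp_wf n (u v : X n.+1) (uv : tgt u = src v) :
  twf (Cons (gc u) (gc (tgt u)) (One (gc v))).
Proof.
rewrite /=; split=> //.
  by rewrite /tgt_to /= ltnn; case: (n) (tgt u) => //= m x; rewrite leqnn.
by rewrite uv /src_to /= ltnn; case: (n) (src v) => //= m x; rewrite leqnn.
Qed.
Lemma comp_dim n (u v : X n.+1) :
  tbounded n.+1 (Cons (gc u) (gc (tgt u)) (One (gc v))).
Proof. by split; exact: leqnn. Qed.
Definition comp_diagram n (u v : X n.+1) (uv : tgt u = src v) : T X n.+1 :=
  Pd (comp_wf uv) (comp_dim u v).
Definition compc n (u v : X n.+1) (uv : tgt u = src v) : X n.+1 :=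
  paste (comp_diagram uv).

Definition hom n (u : X n.+1) (x y : X n) : Prop := src u = x /\ tgt u = y.

Lemma src_id_diagram n (x : X n) : src (id_diagram x) = eta T X n x.
Proof. by apply: pd_eq; rewrite /= src_to_id // /dim /=. Qed.
Lemma tgt_id_diagram n (x : X n) : tgt (id_diagram x) = eta T X n x.
Proof. by apply: pd_eq; rewrite /= tgt_to_id // /dim /=. Qed.
Lemma idc_hom n (x : X n) : hom (idc x) x x.
Proof. by rewrite /hom src_paste tgt_paste src_id_diagram tgt_id_diagram paste_eta. Qed.
Lemma src_to_src (Y : gset) n (u : Y n.+1) : src_to n (gc u) = gc (src u).
Proof. by rewrite /src_to /= ltnn -/(src_to n (gc (src u))) src_to_id // /dim /=. Qed.
Lemma tgt_to_tgt (Y : gset) n (u : Y n.+1) : tgt_to n (gc u) = gc (tgt u).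
Proof. by rewrite /tgt_to /= ltnn -/(tgt_to n (gc (tgt u))) tgt_to_id // /dim /=. Qed.
Lemma compc_hom n (u v : X n.+1) (uv : tgt u = src v) : hom (compc uv) (src u) (tgt v).
Proof.
rewrite /hom src_paste tgt_paste -(paste_eta (src u)) -(paste_eta (tgt v)).
by split; congr paste; apply: pd_eq; rewrite /= /dim /= ltnn ?src_to_src ?tgt_to_tgt.
Qed.

Definition Phi (S : forall n, X n -> Prop) (n : nat) : X n -> Prop :=
  match n with
  | 0 => fun _ => False
  | n'.+1 => fun u =>
      exists (v : X n'.+1) (uv : tgt u = src v) (vu : tgt v = src u) (p q : X n'.+2),
        [/\ S n'.+2 p, hom p (compc uv) (idc (src u)),
            S n'.+2 q & hom q (compc vu) (idc (tgt u))]
  end.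

(* The greatest fixed point of Phi, as the union of its post-fixed points. *)
Definition invertible n (u : X n) : Prop :=
  exists W : forall n, X n -> Prop,
    (forall m (w : X m), W m w -> Phi W w) /\ W n u.

Lemma Phi_mono (S S' : forall n, X n -> Prop) :
  (forall m w, S m w -> S' m w) -> forall m w, Phi S w -> @Phi S' m w.
Proof.
move=> SS [//|m] u [v [uv [vu [p [q [h1 h2 h3 h4]]]]]].
by exists v, uv, vu, p, q; split=> //; exact: SS.
Qed.
Lemma invertible_fix n (u : X n) : invertible u <-> Phi invertible u.
Proof.
split=> [[W [hW Wu]]|h].
  by apply: Phi_mono (hW _ _ Wu) => m w Ww; exists W.
exists (Phi invertible); split=> // m w; apply: Phi_mono => k z [W [hW Wz]].
by apply: Phi_mono (hW _ _ Wz) => l y Wy; exists W.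
Qed.

Definition sim n (x y : X n) : Prop := exists w : X n.+1, hom w x y /\ invertible w.
End WeakCategory.

(* Main.v *)
From mathcomp Require Import all_boot.
From mathcomp Require Import zify.
From Stdlib Require Import ProofIrrelevance.
Require Import Defs.

Set Implicit Arguments.
Unset Strict Implicit.
Unset Printing Implicit Defensive.

(** Let u' be an inverse of u.  An invertible cell w : u -> v has an inverse
    w' : v -> u, and whiskering w' by u' gives a cell from v * u' to u * u', which
    composes with the witness u * u' -> id to a cell v * u' -> id; symmetrically on
    the other side.  So u' is an inverse of v, provided that whiskerings and
    composites of invertible cells are invertible.

    That closure property is proved by coinduction.  Let [gen_inv] be the closure
    of the invertible cells under composition of two n-cells along dimension n-1
    and whiskering by cells of lower dimension, with all coherence cells added
    (those xi(phi, d) whose diagram d is degenerate).  It suffices that [gen_inv]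
    is a post-fixed point of [Phi] ([gen_inv_Phi]).  Write [linked x y] when some
    cell of [gen_inv] goes from x to y.  Then [linked] is transitive, is preserved
    by composition and whiskering, and relates any two parallel composites of the
    same pasting diagram ([linked_coh]).  The inverses are found by calculations
    modulo [linked]:
    - (u * v) * (v' * u') ~ (u * (v * v')) * u' ~ (u * id) * u' ~ u * u' ~ id
      ([rinv_comp]);
    - for a whiskering by a, (u . a) * (v . a) ~ (u * v) . a ~ id . a ~ id
      ([rinv_wr], [rinv_wl]);
    - a coherence cell is inverted by a coherence cell going back ([rinv_coh]).

    To see that two composites are composites of the same diagram, they are formed
    first in the free algebra LX, on the units of the cells involved.  The algebra
    map LX -> X preserves composites ([act_hcomp], [act_compc], [act_idc]), and the
    map [ar] from LX to TX turns them into the strict composites of pasting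
    diagrams ([diag_hcomp]).  There associativity, units and interchange hold as
    equations, and two parallel cells of LX over the same diagram are joined by a
    contraction cell ([coherence]). *)

(** * Pasting in the free algebra *)

Canonical free (L : contracted_monad) (Y : gset) : algebra L :=
  @Algebra L (L Y) (mu L Y) (@mu_eta L Y) (@mu_mu L Y).

Lemma bang_comp (Y Z : gset) (f : gmap Y Z) : gcomp (bang Z) f = bang Y.
Proof.
rewrite /bang; case E: (gcomp _ f) => [g gs gt].
have Eg : g = fun _ _ => tt by move: (congr1 (fun h : gmap Y gone => @gmap_fun _ _ h) E) => /= <-.
by subst g; congr GMap; exact: proof_irrelevance.
Qed.

Lemma parallel_map (Y Z : gset) (f : gmap Y Z) n (x y : Y n) :
  parallel x y -> parallel (f n x) (f n y).
Proof. by case: n x y => //= n x y [es et]; rewrite -!gmap_src -!gmap_tgt es et. Qed.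

Section Paste.
Context {L : contracted_monad}.

(** The arity map interprets a composite in LY strictly, because it is a
    morphism of monads. *)
Lemma ar_paste (Y : gset) n (d : T (L Y) n) :
  ar L Y n (paste (X := free L Y) d) = mu T Y n (fmap T (ar L Y) n d).
Proof.
rewrite /paste /= mmap_mu mmap_nat.
by rewrite (proj1 (@lpairP L (L Y) n _ _ _)).
Qed.

(** The structure map of an algebra is a strict functor out of the free one, by
    the associativity law and the uniqueness of pairs in the pullback LX. *)
Lemma act_paste (X : algebra L) n (d : T (L X) n) :
  act X n (paste (X := free L X) d) = paste (X := X) (fmap T (act X) n d).
Proof.
rewrite {1}/paste /= act_mu; congr (act X n _); apply: lpair_uniq.
  by rewrite mmap_nat (proj1 (@lpairP L (L X) n _ _ _)).
rewrite -fmap_comp bang_comp (proj2 (@lpairP L (L X) n _ _ _)).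
by rewrite -fmap_comp bang_comp.
Qed.
End Paste.

(** The recursion of [glue] cuts the table at level dim w only; at every other level
    it meets a single segment. *)
Lemma glue_pair (Y : gset) d m (u w v : gcell (Tobj Y)) : m <= dim w < m + d ->
  glue d m (Cons u w (One v)) = tcomp (dim w) (entry u) (entry v).
Proof.
elim: d m => [|d IH] m; first by lia.
case: (ltnP m (dim w)) => h k.
  by rewrite glue1 /= ?h // IH //; lia.
have -> : dim w = m by lia.
by rewrite -[Cons u w (One v)]/(tcat (One u) w (One v)) glue2 // !glue_One.
Qed.

(** * Composition of two cells along a lower dimension *)

Section BinaryComposition.
Context {L : contracted_monad} {X : algebra L}.
Implicit Types u v a b : gcell X.

(** The composite is taken at level n, so either cell may have a lower dimension:
    this makes whiskering an instance of binary composition. *)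
Definition composable k n u v :=
  [/\ k < dim u <= n, k < dim v <= n & tgt_to k u = src_to k v].

Lemma pair_wf k n u v : composable k n u v -> twf (Cons u (tgt_to k u) (One v)).
Proof.
case=> /andP[ku un] /andP[kv vn] e.
by split; rewrite //= ?dim_tgt_to ?(minn_idPl (ltnW ku)).
Qed.
Lemma pair_bounded k n u v :
  composable k n u v -> tbounded n (Cons u (tgt_to k u) (One v)).
Proof. by case=> /andP[_ un] /andP[_ vn] _. Qed.

Definition pair_diagram k n u v (H : composable k n u v) : T X n :=
  Pd (pair_wf H) (pair_bounded H).
Definition hcomp k n u v (H : composable k n u v) : X n := paste (pair_diagram H).

Lemma hcomp_eq k n u v u' v' (H : composable k n u v) (H' : composable k n u' v') :
  u = u' -> v = v' -> hcomp H = hcomp H'.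
Proof. by move=> eu ev; congr paste; apply: pd_eq; rewrite /= eu ev. Qed.

Lemma src_hcomp k n u v (H : composable k n.+1 u v)
    (H' : composable k n (src_to n u) (src_to n v)) : src (hcomp H) = hcomp H'.
Proof.
rewrite src_paste; congr paste; apply: pd_eq => /=.
case: H => /andP[ku _] _ _; case: H' => /andP[+ _] _ _.
rewrite dim_src_to dim_tgt_to => h.
by rewrite (_ : minn k (dim u) < n) ?tgt_src_to //; lia.
Qed.
Lemma tgt_hcomp k n u v (H : composable k n.+1 u v)
    (H' : composable k n (tgt_to n u) (tgt_to n v)) : tgt (hcomp H) = hcomp H'.
Proof.
rewrite tgt_paste; congr paste; apply: pd_eq => /=.
case: H => /andP[ku _] _ _; case: H' => /andP[+ _] _ _.
rewrite !dim_tgt_to => h.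
by rewrite (_ : minn k (dim u) < n) ?tgt_tgt_to //; lia.
Qed.

Lemma composable_src k n u v : k < n -> composable k n.+1 u v ->
  composable k n (src_to n u) (src_to n v).
Proof.
move=> kn [/andP[ku un] /andP[kv vn] e].
by split; rewrite ?dim_src_to ?tgt_src_to ?src_src_to //; lia.
Qed.
Lemma composable_tgt k n u v : k < n -> composable k n.+1 u v ->
  composable k n (tgt_to n u) (tgt_to n v).
Proof.
move=> kn [/andP[ku un] /andP[kv vn] e].
by split; rewrite ?dim_tgt_to ?tgt_tgt_to ?src_tgt_to //; lia.
Qed.

Lemma composable_comp n (u v : X n.+1) : tgt u = src v ->
  composable n n.+1 (gc u) (gc v).
Proof. by move=> e; split; rewrite ?tgt_to_tgt ?src_to_src ?e // /dim /= !leqnn. Qed.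

Lemma compc_hcomp n (u v : X n.+1) (uv : tgt u = src v)
    (H : composable n n.+1 (gc u) (gc v)) : compc uv = hcomp H.
Proof. by congr paste; apply: pd_eq; rewrite /= tgt_to_tgt. Qed.

Lemma compc_eq n (u v u' v' : X n.+1) (uv : tgt u = src v) (uv' : tgt u' = src v') :
  u = u' -> v = v' -> compc uv = compc uv'.
Proof. by move=> eu ev; congr paste; apply: pd_eq; rewrite /= eu ev. Qed.

Lemma src_compc n (u v : X n.+1) (uv : tgt u = src v) : src (compc uv) = src u.
Proof. by case: (compc_hom uv). Qed.
Lemma tgt_compc n (u v : X n.+1) (uv : tgt u = src v) : tgt (compc uv) = tgt v.
Proof. by case: (compc_hom uv). Qed.
Lemma src_idc n (x : X n) : src (idc x) = x.
Proof. by case: (idc_hom x). Qed.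
Lemma tgt_idc n (x : X n) : tgt (idc x) = x.
Proof. by case: (idc_hom x). Qed.
(** For a whiskering, composability depends only on the boundary of u of dimension
    k < n, hence only on either of its faces. *)
Lemma composable_wr_src k n (u : X n.+1) a : k < n -> dim a <= n ->
  composable k n.+1 (gc u) a <-> composable k n (gc (src u)) a.
Proof.
move=> kn an; rewrite /composable -src_to_src tgt_src_to //.
by split=> -[h1 /andP[-> _] ->]; split; rewrite // ?(leqW an) ?src_to_src /dim /= ?leqnn ?kn ?leqW.
Qed.
Lemma composable_wr_tgt k n (u : X n.+1) a : k < n -> dim a <= n ->
  composable k n.+1 (gc u) a <-> composable k n (gc (tgt u)) a.
Proof.
move=> kn an; rewrite /composable -tgt_to_tgt tgt_tgt_to; last exact: ltnW.
by split=> -[h1 /andP[-> _] ->]; split; rewrite // ?(leqW an) ?tgt_to_tgt /dim /= ?leqnn ?kn ?leqW.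
Qed.
Lemma composable_wl_src k n (u : X n.+1) a : k < n -> dim a <= n ->
  composable k n.+1 a (gc u) <-> composable k n a (gc (src u)).
Proof.
move=> kn an; rewrite /composable -src_to_src src_src_to; last exact: ltnW.
by split=> -[/andP[-> _] h1 ->]; split; rewrite // ?(leqW an) ?src_to_src /dim /= ?leqnn ?kn ?leqW.
Qed.
Lemma composable_wl_tgt k n (u : X n.+1) a : k < n -> dim a <= n ->
  composable k n.+1 a (gc u) <-> composable k n a (gc (tgt u)).
Proof.
move=> kn an; rewrite /composable -tgt_to_tgt src_tgt_to //.
by split=> -[/andP[-> _] h1 ->]; split; rewrite // ?(leqW an) ?tgt_to_tgt /dim /= ?leqnn ?kn ?leqW.
Qed.

Lemma src_wr k n (u : X n.+1) x a (H : composable k n.+1 (gc u) a)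
    (H' : composable k n (gc x) a) : src u = x -> dim a <= n -> src (hcomp H) = hcomp H'.
Proof.
move=> e an; have [/andP[kn _] _ _] := H'.
rewrite (src_hcomp H (composable_src kn H)).
by apply: hcomp_eq; rewrite ?src_to_src ?e // src_to_id.
Qed.
Lemma tgt_wr k n (u : X n.+1) x a (H : composable k n.+1 (gc u) a)
    (H' : composable k n (gc x) a) : tgt u = x -> dim a <= n -> tgt (hcomp H) = hcomp H'.
Proof.
move=> e an; have [/andP[kn _] _ _] := H'.
rewrite (tgt_hcomp H (composable_tgt kn H)).
by apply: hcomp_eq; rewrite ?tgt_to_tgt ?e // tgt_to_id.
Qed.
Lemma src_wl k n (u : X n.+1) x a (H : composable k n.+1 a (gc u))
    (H' : composable k n a (gc x)) : src u = x -> dim a <= n -> src (hcomp H) = hcomp H'.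
Proof.
move=> e an; have [_ /andP[kn _] _] := H'.
rewrite (src_hcomp H (composable_src kn H)).
by apply: hcomp_eq; rewrite ?src_to_src ?e // src_to_id.
Qed.
Lemma tgt_wl k n (u : X n.+1) x a (H : composable k n.+1 a (gc u))
    (H' : composable k n a (gc x)) : tgt u = x -> dim a <= n -> tgt (hcomp H) = hcomp H'.
Proof.
move=> e an; have [_ /andP[kn _] _] := H'.
rewrite (tgt_hcomp H (composable_tgt kn H)).
by apply: hcomp_eq; rewrite ?tgt_to_tgt ?e // tgt_to_id.
Qed.
End BinaryComposition.

Lemma composable_map (L : contracted_monad) (X Y : algebra L) (f : gmap X Y) k n u v :
  composable k n u v -> composable k n (gmap_cell f u) (gmap_cell f v).
Proof. by case=> h1 h2 e; split=> //; rewrite tgt_to_map src_to_map e. Qed.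

(** * Diagrams of cells of the free algebra, and contraction *)

Section Free.
Context {L : contracted_monad}.

(** The pasting diagram underlying a cell of LY, kept as a bare table so that
    cells of different dimensions can be compared. *)
Definition diag (Y : gset) (c : gcell (L Y)) : table (gcell Y) :=
  entry (gmap_cell (ar L Y) c).

Lemma diag_gc (Y : gset) n (z : L Y n) : diag (gc z) = tab (ar L Y n z).
Proof. by []. Qed.
Lemma diag_wf (Y : gset) (c : gcell (L Y)) : twf (diag c).
Proof. exact: wf_entry. Qed.
Lemma diag_bounded (Y : gset) (c : gcell (L Y)) : tbounded (dim c) (diag c).
Proof. exact: (bounded_entry (gmap_cell (ar L Y) c)). Qed.
Lemma diag_src (Y : gset) m (c : gcell (L Y)) : diag (src_to m c) = tsrc m (diag c).
Proof. by rewrite /diag -src_to_map entry_src. Qed.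
Lemma diag_tgt (Y : gset) m (c : gcell (L Y)) : diag (tgt_to m c) = ttgt m (diag c).
Proof. by rewrite /diag -tgt_to_map entry_tgt. Qed.

Lemma diag_composable (Y : gset) k n u v : @composable L (free L Y) k n u v ->
  ttgt k (diag u) = tsrc k (diag v).
Proof. by case=> _ _ e; rewrite -diag_tgt -diag_src e. Qed.
Lemma diag_hcomp (Y : gset) k n u v (H : @composable L (free L Y) k n u v) :
  diag (gc (hcomp H)) = tcomp k (diag u) (diag v).
Proof.
rewrite diag_gc ar_paste /= glue_pair.
  by rewrite [dim _]dim_tgt_to (minn_idPl _) //; case: H => /andP[/ltnW].
rewrite [dim _]dim_tgt_to; case: H => /andP[h h'] _ _; lia.
Qed.
Lemma diag_compc (Y : gset) n (u v : free L Y n.+1) (e : tgt u = src v) :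
  diag (gc (compc e)) = tcomp n (diag (gc u)) (diag (gc v)).
Proof. by rewrite (compc_hcomp _ (composable_comp e)) diag_hcomp. Qed.
Lemma diag_idc (Y : gset) n (x : free L Y n) : diag (gc (idc x)) = diag (gc x).
Proof. by rewrite diag_gc ar_paste /= glue_One. Qed.
Lemma diag_eta (Y : gset) n (x : Y n) : diag (gc (eta L Y n x)) = One (gc x).
Proof. by rewrite diag_gc mmap_eta. Qed.

(** The contraction lives on L1; it transfers to LY because LY is the pullback of
    TY and L1 over T1. *)
Lemma coherence (Y : gset) n (z1 z2 : L Y n) : parallel z1 z2 ->
  diag (gc z1) = diag (gc z2) ->
  exists c : L Y n.+1, [/\ src c = z1, tgt c = z2 & diag (gc c) = diag (gc z1)].
Proof.
move=> par e; set phi1 := fmap L (bang Y) n z1; set phi2 := fmap L (bang Y) n z2.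
have b : tbounded n.+1 (diag (gc z1)) by apply: bounded_le (diag_bounded _).
pose d : T Y n.+1 := Pd (diag_wf (gc z1)) b.
have ds : src d = ar L Y n z1.
  by apply: pd_eq; rewrite /= tsrc_id //; [exact: diag_wf|exact: (diag_bounded (gc z1))].
have dt : tgt d = ar L Y n z1.
  by apply: pd_eq; rewrite /= ttgt_id //; [exact: diag_wf|exact: (diag_bounded (gc z1))].
have e12 : ar L Y n z1 = ar L Y n z2 by exact: pd_eq.
have p : parallel phi1 phi2 by exact: parallel_map.
have h1 : ar L gone n phi1 = src (fmap T (bang Y) n.+1 d).
  by rewrite -gmap_src ds /phi1 mmap_nat.
have h2 : ar L gone n phi2 = tgt (fmap T (bang Y) n.+1 d).
  by rewrite -gmap_tgt dt /phi2 mmap_nat e12.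
have h : fmap T (bang Y) n.+1 d = ar L gone n.+1 (kappa L phi1 phi2 _ p h1 h2).
  by rewrite ar_kappa.
have [a [[a1 a2] _]] := proj2 (ar_cartesian L (bang Y)) n.+1 d _ h.
have inj z z' : ar L Y n z = ar L Y n z' ->
    fmap L (bang Y) n z = fmap L (bang Y) n z' -> z = z'.
  move=> f1 f2.
  have [c [_ u]] := proj2 (ar_cartesian L (bang Y)) n (ar L Y n z') (fmap L (bang Y) n z')
    (proj1 (ar_cartesian L (bang Y)) n z').
  by rewrite -(u z) // -(u z').
exists a; split; last by rewrite diag_gc a1.
- by apply: inj; rewrite gmap_src ?a1 ?ds // a2 kappa_src.
- by apply: inj; rewrite gmap_tgt ?a1 ?dt // a2 kappa_tgt.
Qed.
End Free.

(** * The structure map preserves composites *)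

Section Act.
Context {L : contracted_monad} {X : algebra L}.
Notation F := (free L X).
Notation xi := (act X).

Lemma act_hcomp k n (u v : gcell F) (H : composable k n u v) u' v'
    (H' : composable k n u' v') :
  gmap_cell xi u = u' -> gmap_cell xi v = v' -> xi n (hcomp H) = hcomp H'.
Proof.
move=> eu ev; rewrite act_paste; congr paste; apply: pd_eq.
by rewrite /= eu ev -tgt_to_map eu.
Qed.
Lemma act_compc n (u v : F n.+1) (e : tgt u = src v) u' v' (e' : tgt u' = src v') :
  xi n.+1 u = u' -> xi n.+1 v = v' -> xi n.+1 (compc e) = compc e'.
Proof.
move=> eu ev; rewrite (compc_hcomp _ (composable_comp e)) (compc_hcomp _ (composable_comp e')).
by apply: act_hcomp; rewrite /gmap_cell /= ?eu ?ev.
Qed.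
Lemma act_idc n (x : F n) x' : xi n x = x' -> xi n.+1 (idc x) = idc x'.
Proof. by move=> <-; rewrite act_paste; congr paste; apply: pd_eq. Qed.
End Act.

(** Since a has dimension at most n, it is its own n-source and n-target, so
    tcomp n a a = a and this is an instance of the interchange law. *)
Lemma comp_whisker_r (Y : gset) k n (u v a : table (gcell Y)) : k < n ->
  twf u -> twf v -> twf a -> tbounded n a ->
  ttgt n u = tsrc n v -> ttgt k u = tsrc k a ->
  tcomp k (tcomp n u v) a = tcomp n (tcomp k u a) (tcomp k v a).
Proof.
move=> kn Wu Wv Wa b e1 e2.
rewrite -interchange ?(ttgt_id Wa b) ?(tsrc_id Wa b) //.
by congr (tcomp k _ _); rewrite -{2}(tsrc_id Wa b) comp_src.
Qed.
Lemma comp_whisker_l (Y : gset) k n (u v a : table (gcell Y)) : k < n ->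
  twf u -> twf v -> twf a -> tbounded n a ->
  ttgt n u = tsrc n v -> ttgt k a = tsrc k u ->
  tcomp k a (tcomp n u v) = tcomp n (tcomp k a u) (tcomp k a v).
Proof.
move=> kn Wu Wv Wa b e1 e2.
rewrite -interchange ?(ttgt_id Wa b) ?(tsrc_id Wa b) //.
by congr (tcomp k _ _); rewrite -{2}(tsrc_id Wa b) comp_src.
Qed.

(** * Cells generated by invertible ones *)

Section Closure.
Context {L : contracted_monad} {X : algebra L}.
Notation F := (free L X).
Notation xi := (act X).
Notation unit_ := (eta L X).
Implicit Types a b : gcell X.

(** Whiskering has k < n and a cell a of dimension at most n: composing along k = n
    with an arbitrary cell would not preserve invertibility. *)
Inductive gen_inv : forall n, X n -> Prop :=
| gen_inv_base n (u : X n) : invertible u -> gen_inv u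
| gen_inv_coh n (z : L X n.+1) : tbounded n (diag (gc z)) -> gen_inv (xi n.+1 z)
| gen_inv_comp n (u v : X n.+1) (uv : tgt u = src v) :
    gen_inv u -> gen_inv v -> gen_inv (compc uv)
| gen_inv_wr k n (u : X n.+1) a (H : composable k n.+1 (gc u) a) :
    k < n -> dim a <= n -> gen_inv u -> gen_inv (hcomp H)
| gen_inv_wl k n (u : X n.+1) a (H : composable k n.+1 a (gc u)) :
    k < n -> dim a <= n -> gen_inv u -> gen_inv (hcomp H).

(** Weak equivalence of cells up to [gen_inv], the rewriting relation in which all
    inverse laws below are computed. *)
Definition linked n (x y : X n) := exists2 c : X n.+1, hom c x y & gen_inv c.

Lemma linked_trans n (y x z : X n) : linked x y -> linked y z -> linked x z.
Proof.
move=> [c [c1 c2] gc'] [d [d1 d2] gd].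
have e : tgt c = src d by rewrite c2.
exists (compc e); last exact: gen_inv_comp.
by split; rewrite ?src_compc ?tgt_compc.
Qed.

Lemma linked_coh n (z1 z2 : L X n) : parallel z1 z2 ->
  diag (gc z1) = diag (gc z2) -> linked (xi n z1) (xi n z2).
Proof.
move=> p e; have [c [c1 c2 c3]] := coherence p e.
exists (xi n.+1 c); first by split; rewrite -?gmap_src -?gmap_tgt ?c1 ?c2.
by apply: gen_inv_coh; rewrite c3; exact: (diag_bounded (gc z1)).
Qed.

Lemma linked_wr k n (x y : X n) a (H : composable k n (gc x) a)
    (H' : composable k n (gc y) a) : linked x y -> linked (hcomp H) (hcomp H').
Proof.
move=> [c [c1 c2] gc']; have [/andP[kn _] /andP[_ an] _] := H.
have Hc : composable k n.+1 (gc c) a by apply/composable_wr_src; rewrite ?c1.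
exists (hcomp Hc); last exact: gen_inv_wr.
by split; [exact: src_wr|exact: tgt_wr].
Qed.
Lemma linked_wl k n (x y : X n) a (H : composable k n a (gc x))
    (H' : composable k n a (gc y)) : linked x y -> linked (hcomp H) (hcomp H').
Proof.
move=> [c [c1 c2] gc']; have [/andP[_ an] /andP[kn _] _] := H.
have Hc : composable k n.+1 a (gc c) by apply/composable_wl_src; rewrite ?c1.
exists (hcomp Hc); last exact: gen_inv_wl.
by split; [exact: src_wl|exact: tgt_wl].
Qed.
Lemma linked_compr n (x y a : X n.+1) (e : tgt x = src a) (e' : tgt y = src a) :
  linked x y -> linked (compc e) (compc e').
Proof.
rewrite (compc_hcomp e (composable_comp e)) (compc_hcomp e' (composable_comp e')).
exact: linked_wr.
Qed.
Lemma linked_compl n (x y a : X n.+1) (e : tgt a = src x) (e' : tgt a = src y) :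
  linked x y -> linked (compc e) (compc e').
Proof.
rewrite (compc_hcomp e (composable_comp e)) (compc_hcomp e' (composable_comp e')).
exact: linked_wl.
Qed.

Definition rinv n (u v : X n.+1) :=
  exists2 uv : tgt u = src v, tgt v = src u & linked (compc uv) (idc (src u)).

Lemma Phi_rinv n (u v : X n.+1) : rinv u v -> rinv v u -> Phi gen_inv u.
Proof.
move=> [uv vu [p hp gp]] [vu' _ [q hq gq]].
exists v, uv, vu', p, q; split=> //; by rewrite uv.
Qed.

Lemma diag_unit_match n (u v : X n.+1) : tgt u = src v ->
  ttgt n (diag (gc (unit_ n.+1 u))) = tsrc n (diag (gc (unit_ n.+1 v))).
Proof. by move=> e; rewrite !diag_eta /= tgt_to_tgt src_to_src e. Qed.

Lemma unit_match n (u v : X n.+1) : tgt u = src v ->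
  tgt (unit_ n.+1 u) = src (unit_ n.+1 v).
Proof. by rewrite -gmap_src -gmap_tgt => ->. Qed.

(** To cancel xi z with xi z', the composite of z and z' may be replaced by any
    zc that is parallel to it and has the same strict composite as diagram. *)
Lemma rinv_via n (z z' zc : F n.+1) : tgt z = src z' -> tgt z' = src z ->
  src zc = src z -> tgt zc = src z ->
  diag (gc zc) = tcomp n (diag (gc z)) (diag (gc z')) ->
  linked (xi n.+1 zc) (idc (xi n (src z))) -> rinv (xi n.+1 z) (xi n.+1 z').
Proof.
move=> zz z'z sc tc ac l.
have e : tgt (xi n.+1 z) = src (xi n.+1 z') by rewrite -gmap_src -gmap_tgt zz.
exists e; rewrite -gmap_src; first by rewrite -gmap_tgt z'z.
apply: linked_trans l; rewrite -(act_compc zz) //; apply: linked_coh.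
  by split; rewrite -?[fobj L X]/(carrier F) ?src_compc ?tgt_compc ?sc ?tc.
by rewrite (diag_compc zz) ac.
Qed.

Lemma linked_idc n (z : F n) (zi : F n.+1) : src zi = z -> tgt zi = z ->
  diag (gc zi) = diag (gc z) -> linked (xi n.+1 zi) (idc (xi n z)).
Proof.
move=> e1 e2 e; rewrite -(act_idc (x := z)) //; apply: linked_coh.
  by split; rewrite -?[fobj L X]/(carrier F) ?src_idc ?tgt_idc.
by rewrite diag_idc.
Qed.

(** A degenerate diagram d is an identity for strict composition, so d composed
    with itself is d, which is also the diagram of the identity of the source. *)
Lemma rinv_coh n (z z' : F n.+1) : tbounded n (diag (gc z)) ->
  diag (gc z') = diag (gc z) -> tgt z = src z' -> tgt z' = src z ->
  rinv (xi n.+1 z) (xi n.+1 z').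
Proof.
move=> b e zz' z'z; have W := diag_wf (gc z).
have es : diag (gc (src z)) = diag (gc z) by rewrite -src_to_src diag_src tsrc_id.
apply: (rinv_via (zc := idc (src z))) => //; rewrite ?src_idc ?tgt_idc //.
  by rewrite diag_idc es e -{2}(tsrc_id W b) comp_src.
by apply: linked_idc; rewrite ?src_idc ?tgt_idc ?diag_idc.
Qed.

(** Cancel the inner pair v * v' first, as for products in a group, with [linked]
    in place of equality. *)
Lemma rinv_comp n (u u' v v' : X n.+1) (uv : tgt u = src v) (vu' : tgt v' = src u') :
  rinv u u' -> rinv v v' -> rinv (compc uv) (compc vu').
Proof.
move=> [uu eu lu] [vv ev lv].
have uvv : tgt u = src (compc vv) by rewrite src_compc.
have uvvu : tgt (compc uvv) = src u' by rewrite !tgt_compc.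
have ui : tgt u = src (idc (src v)) by rewrite src_idc.
have uiu : tgt (compc ui) = src u' by rewrite tgt_compc tgt_idc -uv.
have UV := unit_match uv; have VV := unit_match vv; have VU := unit_match vu'.
have UU := unit_match uu.
have UVV : tgt (unit_ n.+1 u) = @src F _ (compc (X := F) VV) by rewrite src_compc.
have UVVU : @tgt F _ (compc (X := F) UVV) = src (unit_ n.+1 u') by rewrite !tgt_compc.
have UI : tgt (unit_ n.+1 u) = @src F _ (idc (X := F) (unit_ n (src v))).
  by rewrite src_idc -gmap_tgt uv.
have UIU : @tgt F _ (compc (X := F) UI) = src (unit_ n.+1 u').
  by rewrite tgt_compc tgt_idc -gmap_src -uv uu.
rewrite -(act_compc (u := unit_ n.+1 u) (v := unit_ n.+1 v) UV); try exact: act_eta.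
rewrite -(act_compc (u := unit_ n.+1 v') (v := unit_ n.+1 u') VU); try exact: act_eta.
(* The composite is rebracketed as (u * (v * v')) * u'. *)
apply: (rinv_via (zc := compc (X := F) UVVU)); rewrite ?src_compc ?tgt_compc //.
- exact: (unit_match eu).
- exact: (unit_match eu).
- rewrite (diag_compc UVVU) (diag_compc UV) (diag_compc VU).
  rewrite (diag_compc UVV) (diag_compc VV).
  have := (diag_unit_match uv, diag_unit_match vv, diag_unit_match vu').
  move: (diag_wf (gc (unit_ n.+1 u))) (diag_wf (gc (unit_ n.+1 v))).
  move: (diag_wf (gc (unit_ n.+1 v'))) (diag_wf (gc (unit_ n.+1 u'))).
  set a := diag _; set b := diag _; set c := diag _; set d := diag _.
  move=> Wa Wb Wc Wd [[e1 e2] e3].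
  have Wab := wf_comp Wc Wd e1.
  have Wbc := wf_comp Wd Wa e2.
  rewrite -(@compA _ n (tcomp n c d) a b) //; last by rewrite ttgt_comp.
  by rewrite (@compA _ n c d a).
rewrite (act_compc (u := compc (X := F) UVV) (v := unit_ n.+1 u') UVVU uvvu); last first.
- exact: act_eta.
- by apply: act_compc; [exact: act_eta|apply: act_compc; exact: act_eta].
rewrite gmap_src act_eta.
apply: (@linked_trans _ (compc uiu)).
  by apply: linked_compr; apply: linked_compl.
apply: linked_trans lu.
rewrite -(@act_compc _ _ _ _ _ UIU); try exact: act_eta; last first.
  by apply: act_compc; [exact: act_eta|apply: act_idc; exact: act_eta].
rewrite -(@act_compc _ _ _ _ _ UU); try exact: act_eta.
apply: linked_coh.
  by split; rewrite -?[fobj L X]/(carrier F) ?src_compc ?tgt_compc.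
rewrite (diag_compc UIU) (diag_compc UU) (diag_compc UI) diag_idc.
have -> : diag (gc (unit_ n (src v))) = ttgt n (diag (gc (unit_ n.+1 u))).
  by rewrite -diag_tgt tgt_to_tgt -gmap_tgt uv.
by rewrite comp_tgt //; exact: diag_wf.
Qed.

Lemma act_unit (c : gcell X) : gmap_cell xi (gmap_cell unit_ c) = c.
Proof. by case: c => m c; rewrite /gmap_cell /= act_eta. Qed.

(** By interchange, the composite of the whiskerings of u and v is the whiskering
    of u * v; then the cell from u * v to the identity is itself whiskered. *)
Lemma rinv_wr k n (u v : X n.+1) a (H : composable k n.+1 (gc u) a)
    (H' : composable k n.+1 (gc v) a) : k < n -> dim a <= n ->
  rinv u v -> rinv (hcomp H) (hcomp H').
Proof.
move=> kn an [uv vu l].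
pose A : gcell F := gmap_cell unit_ a.
have An : dim A <= n by [].
have HU : @composable L F k n.+1 (gc (unit_ n.+1 u)) A by exact: composable_map H.
have HV : @composable L F k n.+1 (gc (unit_ n.+1 v)) A by exact: composable_map H'.
have UV := unit_match uv; have VU := unit_match vu.
have HUV : @composable L F k n.+1 (gc (compc (X := F) UV)) A.
  by apply/composable_wr_src => //; rewrite src_compc; apply/composable_wr_src.
have HI : @composable L F k n.+1 (gc (idc (X := F) (src (unit_ n.+1 u)))) A.
  by apply/composable_wr_src => //; rewrite src_idc; apply/composable_wr_src.
have Hx : @composable L F k n (gc (src (unit_ n.+1 u))) A by apply/composable_wr_src.
have Hy : @composable L F k n (gc (src (unit_ n.+1 v))) A by apply/composable_wr_src.
have Huv : composable k n.+1 (gc (compc uv)) a.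
  by apply/composable_wr_src => //; rewrite src_compc; apply/composable_wr_src.
have Hi : composable k n.+1 (gc (idc (src u))) a.
  by apply/composable_wr_src => //; rewrite src_idc; apply/composable_wr_src.
have eA := act_unit a; have eU (w : X n.+1) := act_unit (gc w).
rewrite -(act_hcomp HU H (eU u) eA) -(act_hcomp HV H' (eU v) eA).
have sU := @src_wr L F _ _ _ _ _ HU Hx erefl An.
apply: (rinv_via (zc := hcomp HUV)).
- by rewrite (tgt_wr HU Hy) // (src_wr HV Hy).
- by rewrite (tgt_wr HV Hx) // sU.
- by rewrite sU (src_wr HUV Hx) // src_compc.
- by rewrite sU (tgt_wr HUV Hx) // tgt_compc.
- rewrite !diag_hcomp (diag_compc UV).
  apply: comp_whisker_r => //; try exact: diag_wf.
  + by apply: bounded_le An _; exact: diag_bounded.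
  + exact: diag_unit_match.
  + exact: (diag_composable HU).
have eUV : gmap_cell xi (gc (compc (X := F) UV)) = gc (compc uv).
  by congr gc; apply: act_compc; exact: act_eta.
have eI : gmap_cell xi (gc (idc (X := F) (src (unit_ n.+1 u)))) = gc (idc (src u)).
  by congr gc; apply: act_idc; rewrite gmap_src act_eta.
rewrite (act_hcomp HUV Huv eUV eA).
apply: (@linked_trans _ (hcomp Hi)); first exact: linked_wr.
rewrite -(act_hcomp HI Hi eI eA) sU; apply: linked_idc.
- by apply: src_wr => //; rewrite src_idc.
- by apply: tgt_wr => //; rewrite tgt_idc.
- by rewrite !diag_hcomp diag_idc.
Qed.

Lemma rinv_wl k n (u v : X n.+1) a (H : composable k n.+1 a (gc u))
    (H' : composable k n.+1 a (gc v)) : k < n -> dim a <= n ->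
  rinv u v -> rinv (hcomp H) (hcomp H').
Proof.
move=> kn an [uv vu l].
pose A : gcell F := gmap_cell unit_ a.
have An : dim A <= n by [].
have HU : @composable L F k n.+1 A (gc (unit_ n.+1 u)) by exact: composable_map H.
have HV : @composable L F k n.+1 A (gc (unit_ n.+1 v)) by exact: composable_map H'.
have UV := unit_match uv; have VU := unit_match vu.
have HUV : @composable L F k n.+1 A (gc (compc (X := F) UV)).
  by apply/composable_wl_src => //; rewrite src_compc; apply/composable_wl_src.
have HI : @composable L F k n.+1 A (gc (idc (X := F) (src (unit_ n.+1 u)))).
  by apply/composable_wl_src => //; rewrite src_idc; apply/composable_wl_src.
have Hx : @composable L F k n A (gc (src (unit_ n.+1 u))) by apply/composable_wl_src.
have Hy : @composable L F k n A (gc (src (unit_ n.+1 v))) by apply/composable_wl_src.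
have Huv : composable k n.+1 a (gc (compc uv)).
  by apply/composable_wl_src => //; rewrite src_compc; apply/composable_wl_src.
have Hi : composable k n.+1 a (gc (idc (src u))).
  by apply/composable_wl_src => //; rewrite src_idc; apply/composable_wl_src.
have eA := act_unit a; have eU (w : X n.+1) := act_unit (gc w).
rewrite -(act_hcomp HU H eA (eU u)) -(act_hcomp HV H' eA (eU v)).
have sU := @src_wl L F _ _ _ _ _ HU Hx erefl An.
apply: (rinv_via (zc := hcomp HUV)).
- by rewrite (tgt_wl HU Hy) // (src_wl HV Hy).
- by rewrite (tgt_wl HV Hx) // sU.
- by rewrite sU (src_wl HUV Hx) // src_compc.
- by rewrite sU (tgt_wl HUV Hx) // tgt_compc.
- rewrite !diag_hcomp (diag_compc UV).
  apply: comp_whisker_l => //; try exact: diag_wf.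
  + by apply: bounded_le An _; exact: diag_bounded.
  + exact: diag_unit_match.
  + exact: (diag_composable HU).
have eUV : gmap_cell xi (gc (compc (X := F) UV)) = gc (compc uv).
  by congr gc; apply: act_compc; exact: act_eta.
have eI : gmap_cell xi (gc (idc (X := F) (src (unit_ n.+1 u)))) = gc (idc (src u)).
  by congr gc; apply: act_idc; rewrite gmap_src act_eta.
rewrite (act_hcomp HUV Huv eA eUV).
apply: (@linked_trans _ (hcomp Hi)); first exact: linked_wl.
rewrite -(act_hcomp HI Hi eA eI) sU; apply: linked_idc.
- by apply: src_wl => //; rewrite src_idc.
- by apply: tgt_wl => //; rewrite tgt_idc.
- by rewrite !diag_hcomp diag_idc.
Qed.

(** The coinductive step.  The induction needs an inverse for which both
    composites are cancelled by cells of [gen_inv] again, which is what allows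
    [rinv_comp] and the whiskering lemmas to be iterated. *)
Lemma gen_inv_Phi n (u : X n) : gen_inv u -> Phi gen_inv u.
Proof.
(* Cells of dimension 0 need a vacuous clause because [gen_inv_base] applies in
   every dimension. *)
suff H : gen_inv u -> match n return X n -> Prop with
    | 0 => fun _ => False
    | m.+1 => fun u => exists2 v, rinv u v & rinv v u end u.
  by move=> /H; case: n u {H} => // n u [v uv vu]; exact: Phi_rinv uv vu.
elim=> {n u} [n u|n z b|n u v uv _ [u' h1 h2] _ [v' h3 h4]
             |k n u a H kn an _ [v h1 h2]|k n u a H kn an _ [v h1 h2]].
- move/invertible_fix; case: n u => // n u [v [uv [vu [p [q [ip hp iq hq]]]]]].
  exists v; first by exists uv => //; exists p => //; exact: gen_inv_base.
  exists vu => //; exists q; first by rewrite -uv.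
  exact: gen_inv_base.
- have W := diag_wf (gc z).
  have es : diag (gc (src z)) = diag (gc z) by rewrite -src_to_src diag_src tsrc_id.
  have et : diag (gc (tgt z)) = diag (gc z) by rewrite -tgt_to_tgt diag_tgt ttgt_id.
  have p : parallel (tgt z) (src z).
    by case: (n) z {b W es et} => //= m z; rewrite src_src tgt_src.
  have [z' [s' t' e']] := coherence p (etrans et (esym es)).
  have e : diag (gc z') = diag (gc z) by rewrite e' et.
  exists (xi n.+1 z'); first exact: rinv_coh.
  by apply: rinv_coh; rewrite ?e.
- have vu : tgt v' = src u'.
    by case: h1 => e1 _ _; case: h4 => e2 _ _; rewrite -e1 e2 uv.
  by exists (compc vu); apply: rinv_comp.
- have [uv vu _] := h1.
  have H' : composable k n.+1 (gc v) a.
    by apply/composable_wr_src => //; rewrite -uv; apply/composable_wr_tgt.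
  by exists (hcomp H'); apply: rinv_wr.
- have [uv vu _] := h1.
  have H' : composable k n.+1 a (gc v).
    by apply/composable_wl_src => //; rewrite -uv; apply/composable_wl_tgt.
  by exists (hcomp H'); apply: rinv_wl.
Qed.

Lemma gen_inv_invertible n (u : X n) : gen_inv u -> invertible u.
Proof. by exists gen_inv; split=> //; exact: gen_inv_Phi. Qed.

Lemma rinv_invertible n (u v : X n.+1) : rinv u v -> rinv v u -> invertible u.
Proof.
move=> uv vu; apply/invertible_fix; apply: Phi_mono (Phi_rinv uv vu).
exact: gen_inv_invertible.
Qed.
End Closure.

Theorem corollary3p3p17 (L : contracted_monad) (L_initial : is_initial L)
    (X : algebra L) (n : nat) (x y : X n) (u v : X (S n))
    (u_xy : hom u x y) (v_xy : hom v x y)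
    (u_sim_v : sim u v) (u_invertible : invertible u) :
  invertible v.
Proof.
have [ux uy] := u_xy; have [vx vy] := v_xy.
have [w [[ws wt]]] := u_sim_v.
move=> /invertible_fix[w' [ww' [w'w [p [q [ip hp iq hq]]]]]].
(* w' is invertible because the two inverse laws of w are exchanged. *)
have iw' : invertible w'.
  apply/invertible_fix; exists w, w'w, ww', q, p.
  by split; rewrite // ?w'w -?ww'.
have l : linked v u by exists w'; [split; rewrite -?ww' ?w'w|exact: gen_inv_base].
have [u' [uu [u'u [p' [q' [ip' hp' iq' hq']]]]]] := (proj1 (invertible_fix u) u_invertible).
have vu : tgt v = src u' by rewrite vy -uy.
have u'v : tgt u' = src v by rewrite vx -ux.
apply: (@rinv_invertible _ _ _ v u').
  exists vu => //; rewrite vx -ux.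
  apply: linked_trans (linked_compr _ uu l) _.
  by exists p' => //; exact: gen_inv_base.
exists u'v => //; rewrite -uu.
apply: linked_trans (linked_compl _ u'u l) _.
by exists q' => //; exact: gen_inv_base.
Qed.
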